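(* Let $m,p,n$ be positive integers with $p\mid m$ and let $g\in G(m,p,n)$. The shortest reflection factorizations of $g$ form a single orbit under the Hurwitz action if and only if $\operatorname{Par}_{\max}(g)=\{\Pi\}$ is a singleton set and for every part $B\in\Pi$ either $|B|=1$ or $r(B)=1$.
   Context: Let $\omega=\exp(2\pi i/m)$. $G(m,p,n)$ is the group of $n\times n$ complex monomial matrices (exactly one nonzero entry in each row and column) whose nonzero entries are $m$th roots of unity with product an $(m/p)$th root of unity. An element is written $g=[u;(a_1,\ldots,a_n)]$ with $u=\pi(g)\in\mathfrak S_n$ (the underlying permutation) and $a_j\in\mathbb Z/m\mathbb Z$, meaning that the nonzero entry of column $j$ is $\omega^{a_j}$, in row $u(j)$. The weight of a subset $S\subseteq\{1,\ldots,n\}$ in $g$ is $\sum_{j\in S}a_j\in\mathbb Z/m\mathbb Z$. A cycle of $g$ is a cycle of $\pi(g)$ (fixed points count as cycles), and its weight is the weight of its support. A reflection of $G(m,p,n)$ is an element whose fixed space in $\mathbb C^n$ is a hyperplane. A reflection factorization of $g$ is a tuple $(t_1,\ldots,t_\ell)$ of reflections in $G(m,p,n)$ with $t_1\cdots t_\ell=g$; it is shortest if $\ell$ is minimum possible. The Hurwitz action of the braid group on $\ell$ strands on $\ell$-tuples is generated by the moves $\sigma_i$ that replace $(t_i,t_{i+1})$ by $(t_{i+1},\,t_{i+1}^{-1}t_it_{i+1})$ and leave the other entries unchanged. A cycle partition $\Pi$ of $g$ is a set partition of the set of cycles of $g$ such that in each part the cycle weights sum to $0$ modulo $p$. Its value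 is $v(\Pi)=|\Pi|+v_m(\Pi)$, where $|\Pi|$ is the number of parts and $v_m(\Pi)$ is the number of parts whose total weight is $0$ in $\mathbb Z/m\mathbb Z$. $\operatorname{Par}_{\max}(g)$ is the set of cycle partitions of $g$ of maximum value. For a part $B$ containing $|B|$ cycles, with weights $k_1,\ldots,k_{|B|}$, $r(B)=\gcd(m,k_1,\ldots,k_{|B|})$ (computed from any integer representatives of the $k_i$). *)

(* Defs.v *)
From mathcomp Require Import all_boot all_order all_algebra all_fingroup.
From mathcomp Require Import reals trigo complex.
From Stdlib Require Import Relation_Operators.

Set Implicit Arguments.
Unset Strict Implicit.
Unset Printing Implicit Defensive.

Import Order.TTheory GRing.Theory Num.Theory.
Local Open Scope ring_scope.
Local Open Scope complex_scope.

Definition omega (R : realType) (m : nat) : R[i] :=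
  cos (2 * pi / m%:R) +i* sin (2 * pi / m%:R).

Definition monomial_mx (R : realType) (n : nat) (g : 'M[R[i]]_n) : bool :=
  [forall i, #|[set j | g i j != 0]| == 1%N] &&
  [forall j, #|[set i | g i j != 0]| == 1%N].

Definition in_G (R : realType) (m p n : nat) (g : 'M[R[i]]_n) : bool :=
  [&& monomial_mx g,
      [forall i, forall j, (g i j != 0) ==> m.-unity_root (g i j)]
    & (m %/ p).-unity_root (\prod_i \prod_(j | g i j != 0) g i j)].

(* The default values of underlying_perm and exponent are never used on       *)
(* elements of G(m,p,n), for which both choices exist and are unique.         *)
Definition underlying_perm (R : realType) (n : nat) (g : 'M[R[i]]_n) : 'S_n :=
  odflt 1%g [pick u : 'S_n | [forall j, g (u j) j != 0]].

Definition exponent (R : realType) (m n : nat) (g : 'M[R[i]]_n) (j : 'I_n) :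
    nat :=
  if [pick a : 'I_m | g (underlying_perm g j) j == omega R m ^+ a] is Some a
  then a : nat else 0%N.

(* Weights live in Z/m; we keep an unreduced natural representative, which is *)
(* only ever tested for divisibility by p or m (with p %| m) or used inside   *)
(* a gcd with m.  ('Z_m would be wrong for m = 1.)                            *)
Definition weight (R : realType) (m n : nat) (g : 'M[R[i]]_n) (S : {set 'I_n}) :
    nat :=
  (\sum_(j in S) exponent m g j)%N.

(* A cycle is represented by its support. *)
Definition cycles (R : realType) (n : nat) (g : 'M[R[i]]_n) :
    {set {set 'I_n}} :=
  porbits (underlying_perm g).

Definition part_weight (R : realType) (m n : nat) (g : 'M[R[i]]_n)
    (B : {set {set 'I_n}}) : nat :=
  (\sum_(c in B) weight m g c)%N.

Definition cycle_partition (R : realType) (m p n : nat) (g : 'M[R[i]]_n)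
    (P : {set {set {set 'I_n}}}) : bool :=
  partition P (cycles g) && [forall B in P, (p %| part_weight m g B)%N].

Definition value (R : realType) (m n : nat) (g : 'M[R[i]]_n)
    (P : {set {set {set 'I_n}}}) : nat :=
  (#|P| + #|[set B in P | (m %| part_weight m g B)%N]|)%N.

Definition Par_max (R : realType) (m p n : nat) (g : 'M[R[i]]_n) :
    {set {set {set {set 'I_n}}}} :=
  [set P | cycle_partition m p g P &
     [forall Q, cycle_partition m p g Q ==> (value m g Q <= value m g P)%N]].

Definition r_part (R : realType) (m n : nat) (g : 'M[R[i]]_n)
    (B : {set {set 'I_n}}) : nat :=
  gcdn m (\big[gcdn/0%N]_(c in B) weight m g c).

(* Matrices act on column vectors: the rows of eigenspace t^T 1 span the      *)
(* transposes of the vectors v with t *m v = v.                               *)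
Definition reflection (R : realType) (m p n : nat) (t : 'M[R[i]]_n) : bool :=
  in_G m p t && ((\rank (eigenspace t^T 1)).+1 == n).

Definition refl_factorization (R : realType) (m p n : nat) (g : 'M[R[i]]_n)
    (s : seq 'M[R[i]]_n) : Prop :=
  all (@reflection R m p n) s /\ \big[mulmx/1%:M]_(t <- s) t = g.

Definition shortest_refl_factorization (R : realType) (m p n : nat)
    (g : 'M[R[i]]_n) (s : seq 'M[R[i]]_n) : Prop :=
  refl_factorization m p g s /\
  forall s', refl_factorization m p g s' -> (size s <= size s')%N.

Inductive hurwitz_move (R : realType) (n : nat) :
    seq 'M[R[i]]_n -> seq 'M[R[i]]_n -> Prop :=
  HurwitzMove s1 s2 t1 t2 :
    hurwitz_move (s1 ++ [:: t1, t2 & s2])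
                 (s1 ++ [:: t2, invmx t2 *m t1 *m t2 & s2]).

(* Moves are bijective on tuples of invertible matrices, so the orbits of the *)
(* group they generate are the classes of the generated equivalence.          *)
Definition same_hurwitz_orbit (R : realType) (n : nat) :
    seq 'M[R[i]]_n -> seq 'M[R[i]]_n -> Prop :=
  clos_refl_sym_trans _ (@hurwitz_move R n).

Definition single_hurwitz_orbit (R : realType) (n : nat)
    (F : seq 'M[R[i]]_n -> Prop) : Prop :=
  exists s, forall s', F s' <-> same_hurwitz_orbit s s'.

(* Main.v *)
From HB Require Import structures.
Require Import Defs.
From mathcomp Require Import all_boot all_order all_algebra all_fingroup.
From mathcomp Require Import reals trigo complex.
From mathcomp Require Import zify.
From Stdlib Require Import Relation_Operators.

(** Why the theorem is true.

    Reflections of G(m,p,n) are of two kinds: transpositions carrying a weight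
    (swap i j c), and diagonal matrices with a single entry different from 1
    (diag1 i k).  Drawing the transpositions of a factorization of g as edges
    on the n points gives a graph whose components are unions of cycles of g,
    that is, a cycle partition.  Each new edge either joins two components,
    hence two cycles, or changes the number of cycles by at most one, and a
    component of nonzero weight contains a diagonal reflection; so
    length + value >= n + number of cycles (refls_bound).  Every cycle
    partition is the component partition of some factorization with equality
    (tight_exists), so the shortest factorizations are the tight ones whose
    component partition has maximum value.  Hurwitz moves do not change the
    components (hurwitz_comp), so a single orbit leaves room for a single
    optimal partition.

    It remains to decide when the tight factorizations of g with given
    components form one orbit.  Any edge between two points of a component,
    and any diagonal reflection in a component of nonzero weight, can be
    brought to the front (swap_first, diag1_first).  Peeling off such entries
    shows that two tight factorizations with the same components are
    equivalent up to conjugation by a diagonal matrix that is constant on the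
    cycles of g (tight_conj).  So the question is which of these diagonal
    matrices stabilize the orbit.  If S is a union of cycles inside one
    component, and w(S) its weight, the matrix with exponent w(S) on S and 0
    elsewhere does: the orbit contains a factorization that starts with two
    parallel edges between S and the rest of its component, and a move of this
    pair has the effect of the conjugation (Stab_stable).  The form w(S) 1_S is
    quadratic in S, and its polarization puts the square of each cycle weight
    of a component, times the indicator of any of its cycles, in the
    stabilizer.  If the cycle weights and m have no common factor, neither have
    their squares, and every diagonal matrix that is constant on the cycles
    stabilizes the orbit (Stab_cycle, tight_transitive).

    Conversely, suppose that r > 1 divides m and the weights of the at least
    two cycles of a component.  Then there is a tight factorization whose
    entries all preserve a potential modulo r on this component, and so do all
    the members of its orbit.  Conjugation by the diagonal matrix with
    exponent 1 on one of the cycles gives a factorization that does not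
    preserve it (not_Stab).

    The combinatorial part takes place in the wreath product of an additive
    group by a symmetric group; the map Mx identifies the case of Z/m with the
    monomial matrices whose entries are m-th roots of unity. *)

Set Implicit Arguments.
Unset Strict Implicit.
Unset Printing Implicit Defensive.

Import GroupScope Order.TTheory GRing.Theory Num.Theory.

(** * The Hurwitz action in a group *)

Section Hurwitz.
Variable G : groupType.
Implicit Types (x y t w : G) (s p q : seq G).

Inductive hmove : seq G -> seq G -> Prop :=
  HMove p q x y : hmove (p ++ [:: x, y & q]) (p ++ [:: y, x ^ y & q]).

Definition hurwitz : seq G -> seq G -> Prop := clos_refl_sym_trans _ hmove.

Definition prods s : G := \prod_(t <- s) t.

Lemma hurwitz_refl s : hurwitz s s. Proof. exact: rst_refl. Qed.
Lemma hurwitz_sym s s' : hurwitz s s' -> hurwitz s' s.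
Proof. exact: rst_sym. Qed.
Lemma hurwitz_trans s1 s2 s3 : hurwitz s1 s2 -> hurwitz s2 s3 -> hurwitz s1 s3.
Proof. exact: rst_trans. Qed.

Lemma hurwitz_step p q x y : hurwitz (p ++ [:: x, y & q]) (p ++ [:: y,
  x ^ y & q]).
Proof. exact: rst_step. Qed.

Lemma hurwitz_cons t s s' : hurwitz s s' -> hurwitz (t :: s) (t :: s').
Proof.
elim=> [_ _ [p q x y]|s1|s1 s2 _|s1 s2 s3 _ h _]; last 1 first.
- exact: hurwitz_trans.
- exact: (hurwitz_step (t :: p)).
- exact: hurwitz_refl.
- exact: hurwitz_sym.
Qed.

Lemma hurwitz_catl p s s' : hurwitz s s' -> hurwitz (p ++ s) (p ++ s').
Proof. by elim: p => //= t p IHp /IHp; apply: hurwitz_cons. Qed.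

(** An entry travels to the front unchanged, at the price of conjugating the
    entries it overtakes. *)
Lemma hurwitz_front p t q :
  hurwitz (p ++ t :: q) (t :: [seq x ^ t | x <- p] ++ q).
Proof.
elim: p => [|x p IHp] /=; first exact: hurwitz_refl.
by apply: (hurwitz_trans (hurwitz_cons x IHp)); apply: (hurwitz_step [::]).
Qed.

Lemma hurwitz_conj w s s' :
  hurwitz s s' -> hurwitz [seq x ^ w | x <- s] [seq x ^ w | x <- s'].
Proof.
elim=> [_ _ [p q x y]|s1|s1 s2 _|s1 s2 s3 _ h _]; last 1 first.
- exact: hurwitz_trans.
- by rewrite !map_cat /= conjJg; apply: hurwitz_step.
- exact: hurwitz_refl.
- exact: hurwitz_sym.
Qed.

Lemma prods_cons t s : prods (t :: s) = t * prods s.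
Proof. exact: big_cons. Qed.

Lemma prods_conj w s : prods [seq x ^ w | x <- s] = prods s ^ w.
Proof. by rewrite /prods big_map conjg_prod. Qed.

Lemma hurwitz_prods s s' : hurwitz s s' -> prods s = prods s'.
Proof.
elim=> [_ _ [p q x y]|s1|s1 s2 _ ->|s1 s2 s3 _ -> _] //.
by rewrite /prods !big_cat !big_cons /=; congr (_ * _);
  rewrite mulgA [RHS]mulgA (conjgC x y).
Qed.

Lemma hurwitz_size s s' : hurwitz s s' -> size s = size s'.
Proof.
by elim=> [_ _ [p q x y]|s1|s1 s2 _ ->|s1 s2 s3 _ -> _] //; rewrite !size_cat.
Qed.

Lemma hurwitz_forall (P : G -> Prop) s s' :
    (forall x y, P x -> P y -> P (x ^ y)) ->
    (forall x y, P x -> P y -> P (x ^ y^-1)) ->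
  hurwitz s s' -> (forall t, t \in s -> P t) <-> (forall t, t \in s' -> P t).
Proof.
move=> PJ PJV; elim=> [_ _ [p q x y]|s1|s1 s2 _ []|s1 s2 s3 _ [h1 h2] _ [h3
  h4]] //; last first.
  by split=> H; [apply/h3/h1 | apply/h2/h4].
split=> H t; rewrite mem_cat !inE => /or4P[tp|/eqP->|/eqP->|tq].
- by apply: H; rewrite mem_cat tp.
- by apply: H; rewrite mem_cat !inE eqxx !orbT.
- by apply: PJ; apply: H; rewrite mem_cat !inE eqxx !orbT.
- by apply: H; rewrite mem_cat !inE tq !orbT.
- by apply: H; rewrite mem_cat tp.
- rewrite -[x](conjgK y).
  by apply: PJV; apply: H; rewrite mem_cat !inE eqxx ?orbT.
- by apply: H; rewrite mem_cat !inE eqxx !orbT.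
- by apply: H; rewrite mem_cat !inE tq !orbT.
Qed.

End Hurwitz.

(** * Wreath products *)

(** The pair (u, a) stands for the monomial map sending the row basis vector
    at x to the one at u x, scaled by a x; products are read from left to
    right, as for permutations. *)
Definition wreath (T : finType) (A : zmodType) : Type :=
  ({perm T} * {ffun T -> A})%type.

Section WreathGroup.
Variables (T : finType) (A : zmodType).
Local Notation W := (wreath T A).
HB.instance Definition _ := Choice.on W.

Definition wr (u : {perm T}) (a : {ffun T -> A}) : W := (u, a).
Definition wone : W := wr 1 [ffun=> 0%R].
Definition wmul (g h : W) : W :=
  wr (g.1 * h.1) [ffun x => (g.2 x + h.2 (g.1 x))%R].
Definition winv (g : W) : W :=
  wr g.1^-1 [ffun x => (- g.2 (g.1^-1%g x))%R].

Lemma wmulA : associative wmul.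
Proof.
move=> [u a] [v b] [w c]; rewrite /wmul /wr /= mulgA; congr (_, _).
by apply/ffunP=> x; rewrite !ffunE addrA permM.
Qed.

Lemma wmul1g : left_id wone wmul.
Proof.
move=> [u a]; rewrite /wmul /wr /= mul1g; congr (_, _).
by apply/ffunP=> x; rewrite !ffunE add0r perm1.
Qed.

Lemma wmulg1 : right_id wone wmul.
Proof.
move=> [u a]; rewrite /wmul /wr /= mulg1; congr (_, _).
by apply/ffunP=> x; rewrite !ffunE addr0.
Qed.

Lemma wmulVg : left_inverse wone winv wmul.
Proof.
move=> [u a]; rewrite /wmul /wr /= mulVg; congr (_, _).
by apply/ffunP=> x; rewrite !ffunE addNr.
Qed.

Lemma wmulgV : right_inverse wone winv wmul.
Proof.
move=> [u a]; rewrite /wmul /wr /= mulgV; congr (_, _).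
by apply/ffunP=> x; rewrite !ffunE permK subrr.
Qed.

HB.instance Definition _ :=
  isGroup.Build W wmulA wmul1g wmulg1 wmulVg wmulgV.

Lemma wr12E x : (1 : W).2 x = 0%R. Proof. by rewrite /= ffunE. Qed.
Lemma wrM1 (g h : W) : (g * h).1 = g.1 * h.1. Proof. by []. Qed.
Lemma wrM2 (g h : W) x : (g * h).2 x = (g.2 x + h.2 (g.1 x))%R.
Proof. by rewrite /= ffunE. Qed.
Lemma wrV1 (g : W) : (g^-1).1 = (g.1)^-1. Proof. by []. Qed.
Lemma wrV2 (g : W) x : (g^-1).2 x = (- g.2 (g.1^-1%g x))%R.
Proof. by rewrite /= ffunE. Qed.
Lemma wrJ1 (g h : W) : (g ^ h).1 = g.1 ^ h.1. Proof. by []. Qed.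

Lemma wr_eq (g h : W) : g.1 = h.1 -> g.2 =1 h.2 -> g = h.
Proof. by case: g h => u a [v b] /= -> /ffunP->. Qed.

Lemma wrJ2 (g h : W) x :
  (g ^ h).2 (h.1 x) = (g.2 x - h.2 x + h.2 (g.1 x))%R.
Proof.
by rewrite conjgE wrM2 wrM2 wrV2 wrV1 permK addrCA addrA.
Qed.

End WreathGroup.

(** * Labelings *)

Section Labelings.
Variables (T : finType) (A : zmodType).
Implicit Types (a b : T -> A) (L : finType) (u : {perm T}).

Definition nlabels L (f : T -> L) : nat := #|f @: [set: T]|.
Definition wt L (f : T -> L) a y : A := (\sum_(x | f x == y) a x)%R.
Definition nnonzero L (f : T -> L) a : nat := #|[set y | wt f a y != 0%R]|.
(** Labelings matter only through the partition of T that they induce. *)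
Definition same_kernel L L' (f : T -> L) (f' : T -> L') : Prop :=
  forall x y, (f x == f y) = (f' x == f' y).

Lemma same_kernel_sym L L' (f : T -> L) (f' : T ->
  L') : same_kernel f f' -> same_kernel f' f.
Proof. by move=> H x y; rewrite H. Qed.

Lemma same_kernel_trans L1 L2 L3 (f : T -> L1) (g : T -> L2) (h : T -> L3) :
  same_kernel f g -> same_kernel g h -> same_kernel f h.
Proof. by move=> H1 H2 x y; rewrite H1 H2. Qed.

Lemma card_imset_same_kernel L L' (f : T -> L) (f' : T -> L') (X : {set T}) :
  same_kernel f f' -> #|f @: X| = #|f' @: X|.
Proof.
(* both count the fibres met by X *)
have fib (M : finType) (h : T -> M) : #|h @: X| = #|(fun x =>
  [set y | h y == h x]) @: X|.
  rewrite (imset_comp (fun z => [set y | h y == z]) h) [RHS]card_in_imset //.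
  move=> _ z /imsetP[x _ ->] _ /setP/(_ x).
  by rewrite !inE eqxx => /esym/eqP.
move=> H; rewrite (fib _ f) (fib _ f'); congr #|pred_of_set _|.
by apply: eq_imset => x; apply/setP=> y; rewrite !inE H.
Qed.

Lemma nlabels_same_kernel L L' (f : T -> L) (f' : T ->
  L') : same_kernel f f' -> nlabels f = nlabels f'.
Proof. exact: card_imset_same_kernel. Qed.

Lemma wt_same_kernel L L' (f : T -> L) (f' : T -> L') a x :
  same_kernel f f' -> wt f a (f x) = wt f' a (f' x).
Proof. by move=> H; apply: eq_bigl => y; rewrite H. Qed.

Lemma wt_empty L (f : T -> L) a y : y \notin f @: [set: T] -> wt f a y = 0%R.
Proof.
by move=> yf; rewrite /wt big1 // => x /eqP fx; case/imsetP: yf; exists x.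
Qed.

Lemma nnonzeroE L (f : T -> L) a :
  nnonzero f a = #|f @: [set x | wt f a (f x) != 0%R]|.
Proof.
apply: eq_card => y; rewrite inE.
apply/idP/imsetP => [ny|[x]]; last by rewrite inE => ? ->.
case: (boolP (y \in f @: [set: T])) => [/imsetP[x _ E]|/(wt_empty a) E].
  by exists x; rewrite // inE -E.
by rewrite E eqxx in ny.
Qed.

Lemma nnonzero_same_kernel L L' (f : T -> L) (f' : T -> L') a :
  same_kernel f f' -> nnonzero f a = nnonzero f' a.
Proof.
move=> H; rewrite !nnonzeroE (card_imset_same_kernel _ H).
suff -> : [set x | wt f a (f x) != 0%R] = [set x | wt f' a (f' x) != 0%R] by [].
by apply/setP=> x; rewrite !inE (wt_same_kernel _ _ H).
Qed.

Lemma eq_nnonzero L (f : T -> L) a b : wt f a =1 wt f b ->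
  nnonzero f a = nnonzero f b.
Proof.
by move=> E; apply: eq_card => y; rewrite !inE E.
Qed.

Lemma nnonzero0P L (f : T -> L) a : nnonzero f a = 0 ->
  forall y, wt f a y = 0%R.
Proof.
move/eqP; rewrite cards_eq0 => /eqP/setP H y; move/(_ y): H.
by rewrite !inE => /negbFE/eqP.
Qed.

Lemma nnonzero_gt0P L (f : T -> L) a : nnonzero f a != 0 ->
  exists x, wt f a (f x) != 0%R.
Proof.
rewrite nnonzeroE cards_eq0 => /set0Pn[_ /imsetP[x + _]]; rewrite inE => H.
by exists x.
Qed.

Definition merge L i j (f : T -> L) x := if f x == f i then f j else f x.

Lemma merge_eq L i j (f : T -> L) : f i = f j -> merge i j f =1 f.
Proof. by move=> E x; rewrite /merge -E; case: eqP. Qed.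

Lemma mergeC L i j (f : T -> L) : same_kernel (merge i j f) (merge j i f).
Proof.
move=> x y; rewrite /merge.
by case: (f x =P f i) (f x =P f j) (f y =P f i) (f y =P f j)
  => xi [] xj [] yi [] yj; apply/eqP/eqP; congruence.
Qed.

Lemma merge_same_kernel L L' i j (f : T -> L) (f' : T -> L') :
  same_kernel f f' -> same_kernel (merge i j f) (merge i j f').
Proof.
by move=> H x y; rewrite /merge !(H _ i) [LHS](fun_if (fun z => z == _)) 
  [RHS](fun_if (fun z => z == _)); do 2!case: ifP => _; rewrite ?eqxx ?H.
Qed.

Lemma nlabels_merge L i j (f : T -> L) :
  f i != f j -> nlabels f = (nlabels (merge i j f)).+1.
Proof.
move=> ij; rewrite /nlabels (cardsD1 (f i)) imset_f //= add1n; congr _.+1.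
apply: eq_card => y; rewrite !inE.
apply/andP/imsetP => [[yi /imsetP[x _ E]]|[x _ ->]]; rewrite /merge.
  by exists x; rewrite // -E (negPf yi).
by case: (eqVneq (f x) (f i)) => [_|xi];
  rewrite ?(eq_sym (f j)) ?ij ?xi imset_f.
Qed.

Lemma wt_merge_eq L i j (f : T -> L) a : f i != f j ->
  wt (merge i j f) a (f j) = (wt f a (f i) + wt f a (f j))%R.
Proof.
move=> ij; rewrite /wt (bigID (fun x => f x == f i)) /=; congr (_ + _)%R.
  apply: eq_bigl => x; rewrite /merge; case: (eqVneq (f x) (f i)) => _.
    by rewrite eqxx.
  by rewrite andbF.
apply: eq_bigl => x; rewrite /merge; case: (eqVneq (f x) (f i)) => [->|_].
  by rewrite andbF (negPf ij).
by rewrite andbT.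
Qed.

Lemma wt_merge_neq L i j (f : T -> L) a y : y != f i -> y != f j ->
  wt (merge i j f) a y = wt f a y.
Proof.
move=> yi yj; apply: eq_bigl => x; rewrite /merge.
case: (eqVneq (f x) (f i)) => [->|_] //.
by rewrite !(eq_sym _ y) (negPf yi) (negPf yj).
Qed.

Lemma wt_merge0 L i j (f : T -> L) a : f i != f j ->
  wt (merge i j f) a (f i) = 0%R.
Proof.
move=> ij; rewrite /wt big_pred0 // => x; rewrite /merge.
by case: (eqVneq (f x) (f i)) => [_|/negPf->]; rewrite // eq_sym (negPf ij).
Qed.

(** Of the two merged labels, one disappears, and the other one ends with a
    nonzero total only if one of the two totals was nonzero. *)
Lemma nnonzero_merge L i j (f : T ->
  L) a : nnonzero (merge i j f) a <= nnonzero f a.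
Proof.
case: (eqVneq (f i) (f j)) => [/(merge_eq)E|ij].
  have S : same_kernel (merge i j f) f by move=> x y; rewrite !E.
  by rewrite (nnonzero_same_kernel _ S).
set X := [set y | wt f a y != 0%R];
  set Y := [set y | wt (merge i j f) a y != 0%R].
have YX : Y \subset f j |: X :\ f i.
  apply/subsetP=> y; rewrite !inE; case: (eqVneq y (f j)) => //= yj.
  case: (eqVneq y (f i)) => [->|yi]; first by rewrite wt_merge0 ?eqxx.
  by rewrite wt_merge_neq.
case: (boolP (f j \in Y)) => [Yj|nYj]; last first.
  apply/subset_leq_card/subsetP=> y yY; move: (subsetP YX y yY).
  by rewrite !inE => /orP[/eqP E|/andP[]//]; rewrite -E yY in nYj.
case: (boolP (f j \in X)) => [Xj|nXj].
  apply/subset_leq_card/subsetP=> y yY; move: (subsetP YX y yY).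
  by rewrite in_setU1 in_setD1 => /orP[/eqP->|/andP[]].
have Xi : f i \in X.
  move: Yj nXj; rewrite !inE wt_merge_eq // negbK => Yj /eqP E.
  by rewrite E addr0 in Yj.
apply: leq_trans (subset_leq_card YX) _.
rewrite cardsU1 in_setD1 (negPf nXj) andbF.
by rewrite /nnonzero -/X (cardsD1 (f i) X) Xi.
Qed.

(** Changing the weight of a single point changes at most one total. *)
Lemma nnonzero_change1 L (f : T -> L) a b i : (forall x, x != i -> a x = b x) ->
  nnonzero f a <= (nnonzero f b).+1.
Proof.
move=> E; apply: (@leq_trans #|f i |: [set y | wt f b y != 0%R]|); last first.
  by rewrite cardsU1; case: (_ \notin _).
apply/subset_leq_card/subsetP=> y; rewrite !inE.
case: (eqVneq y (f i)) => //= yi; congr (_ != _); apply: eq_bigr => x /eqP fx.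
by rewrite E //; apply: contraNneq yi => <-; rewrite fx.
Qed.

Definition refine L (S : {set T}) (f : T -> L) x : bool * L := (x \in S, f x).

Section Split.
Variables (L : finType) (f : T -> L) (S : {set T}) (i j : T).
Hypotheses (iS : i \in S) (jS : j \notin S) (fij : f i = f j).
Hypothesis Sf : forall x, x \in S -> f x = f i.

Lemma nlabels_refine : nlabels (refine S f) = (nlabels f).+1.
Proof.
rewrite /nlabels; have ->
  : refine S f @: [set: T] = (true, f i) |: pair false @: (f @: [set: T]).
  apply/setP=> -[[] y]; rewrite !inE.
    apply/imsetP/orP => [[x _ [xS ->]]|[/eqP[->]|]].
    - by left; rewrite Sf.
    - by exists i; rewrite // /refine iS.
    - by case/imsetP=> z _ [].
  rewrite xpair_eqE /=.
  rewrite (@mem_imset _ _ (pair false)); last by move=> ? ? [].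
  apply/imsetP/imsetP => [[x _ [_ ->]]|[x _ ->]]; first by exists x.
  case: (boolP (x \in S)) => xS; last by exists x;
    rewrite // /refine (negPf xS).
  by exists j; rewrite // /refine (negPf jS) Sf ?fij.
rewrite cardsU1 card_imset; last by move=> ? ? [].
suff -> : (true, f i) \notin pair false @: (f @: [set: T]) by [].
by apply/imsetP=> -[].
Qed.

Lemma wt_refine_in a : wt (refine S f) a (true, f i) = (\sum_(x in S) a x)%R.
Proof.
apply: eq_bigl => x; rewrite /refine xpair_eqE eqb_id.
by case: (boolP (x \in S)) => //= /Sf->; rewrite eqxx.
Qed.

Lemma wt_refine_out a y : (\sum_(x in S) a x)%R = 0%R ->
  wt (refine S f) a (false, y) = wt f a y.
Proof.
move=> S0; rewrite [RHS]/wt (bigID (mem S)) /= [X in (X + _)%R](_ : _ = 0%R).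
  rewrite add0r; apply: eq_bigl => x.
  by rewrite /refine xpair_eqE eqbF_neg andbC.
case: (eqVneq y (f i)) => [->|yi].
  rewrite -[RHS]S0; apply: eq_bigl => x.
  by case: (boolP (x \in S)) => [/Sf->|]; rewrite ?eqxx ?andbF.
rewrite big_pred0 // => x; apply/negP=> /andP[/eqP fx /Sf E].
by rewrite -fx E eqxx in yi.
Qed.

Lemma wt_refine a y : (\sum_(x in S) a x)%R = 0%R ->
  wt (refine S f) a y = if y.1 then 0%R else wt f a y.2.
Proof.
case: y => -[] y S0 /=; last exact: wt_refine_out.
case: (eqVneq y (f i)) => [->|yi]; first by rewrite wt_refine_in.
apply: wt_empty; apply/imsetP=> -[x _ [/esym/Sf E fx]].
by rewrite fx E eqxx in yi.
Qed.

Lemma nnonzero_refine a : (\sum_(x in S) a x)%R = 0%R ->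
  nnonzero (refine S f) a = nnonzero f a.
Proof.
move=> S0; rewrite /nnonzero -(card_imset [set y | wt f a y != 0%R] (f :=
  pair false)).
  apply: eq_card => -[b y]; rewrite inE wt_refine //=.
  case: b; first by rewrite eqxx; apply/esym/negP=> /imsetP[].
  by rewrite (@mem_imset _ _ (pair false)) ?inE // => ? ? [].
by move=> ? ? [].
Qed.

(** Splitting off S and then merging along an edge from S to the rest of the
    class restores the classes. *)
Lemma merge_refine (M : finType) (f' : T -> M) :
  same_kernel f' (refine S f) -> same_kernel (merge i j f') f.
Proof.
move=> H; apply: same_kernel_trans (merge_same_kernel _ _ H) _ => x y.
have Si z : (refine S f z == refine S f i) = (z \in S).
  rewrite /refine iS xpair_eqE eqb_id.
  by case: (boolP (z \in S)) => //= /Sf->; rewrite eqxx.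
rewrite /merge !Si /refine (negPf jS) -fij.
case: (boolP (x \in S)) => [/Sf->|_]; case: (boolP (y \in S)) => [/Sf->|_];
  by rewrite ?xpair_eqE ?eqxx.
Qed.

End Split.

End Labelings.

(** * Reflections and the graph of a factorization *)

Section Reflections.
Variables (T : finType) (A : zmodType) (K : A -> bool).
Local Notation W := (wreath T A).
Implicit Types (i j x y : T) (k c : A) (g t w : W) (s p q : seq W).

Definition swap i j c : W :=
  wr (tperm i j)
     [ffun x => (if x == i then c else if x == j then - c else 0)%R].
Definition diag1 i k : W := wr 1 [ffun x => (if x == i then k else 0)%R].

Inductive refl : W -> Prop :=
| ReflSwap i j c of i != j : refl (swap i j c)
| ReflDiag1 i k of k != 0%R & K k : refl (diag1 i k).

Definition refls s : Prop := forall t, t \in s -> refl t.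

Lemma refls_cons t s : refls (t :: s) <-> refl t /\ refls s.
Proof.
split=> [H|[rt rs] x].
  by split=> [|x xs]; apply: H; rewrite inE ?eqxx ?xs ?orbT.
by rewrite inE => /orP[/eqP->|/rs].
Qed.

Lemma swapJ i j c w : i != j ->
  swap i j c ^ w = swap (w.1 i) (w.1 j) (c - w.2 i + w.2 j)%R.
Proof.
move=> ij; apply: wr_eq => [|z]; first by rewrite wrJ1 tpermJ.
rewrite -[z](permKV w.1) wrJ2 !ffunE !(inj_eq perm_inj) /=.
have [->|zi] := eqVneq (w.1^-1 z) i; first by rewrite tpermL.
have [->|zj] := eqVneq (w.1^-1 z) j;
  last by rewrite tpermD 1?eq_sym // sub0r addNr.
by rewrite tpermR !opprD opprK addrAC.
Qed.

Lemma diag1J i k w : diag1 i k ^ w = diag1 (w.1 i) k.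
Proof.
apply: wr_eq => [|z]; first by rewrite wrJ1 conj1g.
rewrite -[z](permKV w.1) wrJ2 !ffunE !(inj_eq perm_inj) /= perm1.
by rewrite addrNK.
Qed.

Lemma swapC i j c : i != j -> swap i j c = swap j i (- c)%R.
Proof.
move=> ij; apply: wr_eq => [|z] /=; first by rewrite tpermC.
rewrite !ffunE opprK; case: (eqVneq z i) => [->|//].
by rewrite (negPf ij).
Qed.

Lemma refl_conj t w : refl t -> refl (t ^ w).
Proof.
case=> [i j c ij|i k k0 Kk]; last by rewrite diag1J; apply: ReflDiag1.
by rewrite swapJ //; apply: ReflSwap; rewrite (inj_eq perm_inj).
Qed.

Lemma hurwitz_refls s s' : hurwitz s s' -> refls s <-> refls s'.
Proof. by apply: hurwitz_forall => x y rx _; apply: refl_conj. Qed.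

Lemma refls_conj s w : refls s -> refls [seq t ^ w | t <- s].
Proof. by move=> rs _ /mapP[t /rs rt ->]; apply: refl_conj. Qed.

Definition keeps (X : Type) (f : T -> X) t : Prop := forall x, f (t.1 x) = f x.

Lemma keepsM X (f : T -> X) g t : keeps f g -> keeps f t -> keeps f (g * t).
Proof. by move=> fg ft x; rewrite wrM1 permM ft fg. Qed.

Lemma keepsV X (f : T -> X) g : keeps f g -> keeps f g^-1.
Proof. by move=> fg x; rewrite wrV1 -fg permKV. Qed.

Lemma keepsJ X (f : T -> X) g t : keeps f g -> keeps f t -> keeps f (g ^ t).
Proof. by move=> fg ft; rewrite conjgE; do !apply: keepsM => //;
  apply: keepsV. Qed.

Lemma keeps_diag1 X (f : T -> X) i k : keeps f (diag1 i k).
Proof. by move=> x; rewrite perm1. Qed.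

Lemma keeps_swap X (f : T -> X) i j c : keeps f (swap i j c) <-> f i = f j.
Proof.
split=> [/(_ i)|E x /=]; first by rewrite /= tpermL.
by case: tpermP => // ->.
Qed.

Lemma keeps_prods X (f : T -> X) s :
  (forall t, t \in s -> keeps f t) -> keeps f (prods s).
Proof.
elim: s => [|t s IHs] H; first by rewrite /prods big_nil => x; rewrite perm1.
rewrite prods_cons; apply: keepsM; first by apply: H; rewrite mem_head.
by apply: IHs => x xs; apply: H; rewrite inE xs orbT.
Qed.

(** Labels for the connected components of the graph on T whose edges are the
    entries of s that move points, computed by successive merging. *)
Fixpoint comp s : T -> T :=
  if s is t :: s' then
    if [pick x | t.1 x != x] is Some x then merge x (t.1 x) (comp s')
    else comp s'
  else id.

Lemma comp_diag1 i k s : comp (diag1 i k :: s) = comp s.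
Proof. by rewrite /=; case: pickP => // x; rewrite perm1 eqxx. Qed.

Lemma comp_swap i j c s : i != j ->
  same_kernel (comp (swap i j c :: s)) (merge i j (comp s)).
Proof.
move=> ij /=; case: pickP => [x|/(_ i)]; last by rewrite tpermL eq_sym ij.
case: tpermP => [->|->|_ _]; rewrite ?eqxx // => _ => //.
exact: mergeC.
Qed.

Lemma mergeLR (L : finType) i j (f : T -> L) : merge i j f i = merge i j f j.
Proof. by rewrite /merge eqxx; case: ifP. Qed.

Lemma merge_univ X (L : finType) i j (c : T -> L) (f : T -> X) :
    (forall x y, c x = c y -> f x = f y) -> f i = f j ->
  forall x y, merge i j c x = merge i j c y -> f x = f y.
Proof.
move=> cf fij x y; rewrite /merge.
case: eqP => [/cf Ex|_]; case: eqP => [/cf Ey|_] /cf; congruence.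
Qed.

Lemma merge_coarse (L : finType) i j (c : T -> L) x y :
  c x = c y -> merge i j c x = merge i j c y.
Proof. by move=> E; rewrite /merge E. Qed.

Lemma same_kernelP (L L' : finType) (f : T -> L) (f' : T -> L') x y :
  same_kernel f f' -> f x = f y <-> f' x = f' y.
Proof.
by move=> H; split=> /eqP; [rewrite H | rewrite -H] => /eqP.
Qed.

Lemma comp_keeps s : refls s -> forall t, t \in s -> keeps (comp s) t.
Proof.
elim: s => // t s IHs /refls_cons[rt /IHs {}IHs].
case: rt => [i j c ij|i k _ _] t'; rewrite inE; last first.
  by rewrite comp_diag1 => /orP[/eqP->|/IHs//]; apply: keeps_diag1.
have H := comp_swap c s ij; case/orP=> [/eqP->|/IHs kt x].
  by apply/keeps_swap/(same_kernelP _ _ H)/mergeLR.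
by apply/(same_kernelP _ _ H)/merge_coarse.
Qed.

(** By this universal property the components depend only on the labelings
    that all entries preserve, and those are invariant under Hurwitz moves. *)
Lemma comp_univ s X (f : T -> X) : refls s ->
  (forall t, t \in s -> keeps f t) ->
  forall x y, comp s x = comp s y -> f x = f y.
Proof.
elim: s => [|t s IHs]; first by move=> _ _ x y /= ->.
move=> /refls_cons[rt rs] H; have Ht := H t (mem_head _ _).
have Hs t' : t' \in s -> keeps f t' by move=> ts; apply: H; rewrite inE ts orbT.
have {}IHs := IHs rs Hs.
case: rt Ht => [i j c ij /keeps_swap fij|i k _ _ _]; last by rewrite comp_diag1.
by move=> x y /(same_kernelP _ _ (comp_swap c s ij)); apply: merge_univ.
Qed.

Lemma comp_prods s : refls s -> keeps (comp s) (prods s).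
Proof. by move/comp_keeps/keeps_prods. Qed.

Lemma hurwitz_keeps X (f : T -> X) s s' : hurwitz s s' ->
  (forall t, t \in s -> keeps f t) <-> (forall t, t \in s' -> keeps f t).
Proof.
apply: hurwitz_forall => g t fg ft; first exact: keepsJ.
by apply: keepsJ => //; apply: keepsV.
Qed.

Lemma hurwitz_comp s s' : refls s -> hurwitz s s' ->
  same_kernel (comp s) (comp s').
Proof.
move=> rs ss'; have rs' : refls s' by apply/(hurwitz_refls ss').
move=> x y; apply/eqP/eqP; apply: comp_univ => //.
  exact/(hurwitz_keeps _ ss')/comp_keeps.
exact/(hurwitz_keeps _ ss')/comp_keeps.
Qed.

Lemma wtM (L : finType) (f : T -> L) g t (y : L) : keeps f g ->
  wt f (g * t).2 y = (wt f g.2 y + wt f t.2 y)%R.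
Proof.
move=> fg; rewrite /wt [X in (_ + X)%R](reindex_inj (@perm_inj _ g.1)) /=.
under [X in (_ + X)%R]eq_bigl do rewrite fg.
by rewrite -big_split; apply: eq_bigr => x _; rewrite wrM2.
Qed.

Lemma wt_swap (L : finType) (f : T -> L) i j c (y : L) : i != j -> f i = f j ->
  wt f (swap i j c).2 y = 0%R.
Proof.
move=> ij fij; rewrite /wt.
case: (eqVneq (f i) y) => [<-|yi]; last first.
  rewrite big1 // => x /eqP fx; rewrite ffunE.
  case: eqP => [xi|_]; first by rewrite -fx xi eqxx in yi.
  by case: eqP => // xj; rewrite -fx xj fij eqxx in yi.
rewrite (bigD1 i) //= (bigD1 j) /=; last by rewrite fij eqxx eq_sym.
rewrite big1 => [|x /andP[/andP[_ xi] xj]]; last first.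
  by rewrite ffunE (negPf xi) (negPf xj).
by rewrite !ffunE !eqxx eq_sym (negPf ij) addr0 subrr.
Qed.

Lemma wt_diag1 (L : finType) (f : T -> L) i k (y : L) :
  wt f (diag1 i k).2 y = if y == f i then k else 0%R.
Proof.
rewrite /wt; case: eqP => [->|yi].
  rewrite (bigD1 i) //= big1 => [|x /andP[_ /negPf xi]];
    last by rewrite ffunE xi.
  by rewrite ffunE eqxx addr0.
rewrite big1 // => x /eqP fx; rewrite ffunE.
by case: eqP => // xi; case: yi; rewrite -fx xi.
Qed.

Definition ncycles g : nat := #|porbits g.1|.

Lemma cyc1 g : g.1 = 1 -> ncycles g = #|T|.
Proof.
rewrite /ncycles => ->; rewrite card_imset // => x y /setP/(_ x).
by rewrite porbit_id => /esym/porbitP[n ->]; rewrite expg1n perm1.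
Qed.

Lemma ncycles_swap i j c g : i != j ->
  ncycles (swap i j c * g) + (i \notin porbit g.1 j).*2 = (ncycles g).+1.
Proof.
by move=> ij; rewrite /ncycles wrM1 porbits_mul_tperm ij addn1.
Qed.

Lemma ncycles_diag1 i k g : ncycles (diag1 i k * g) = ncycles g.
Proof. by rewrite /ncycles wrM1 mul1g. Qed.

Lemma keeps_porbit X (f : T -> X) g x y :
  keeps f g -> y \in porbit g.1 x -> f y = f x.
Proof.
move=> fg /porbitP[n ->]; elim: n => [|n IHn]; first by rewrite perm1.
by rewrite expgSr permM fg.
Qed.

(** Since the value of a cycle partition is twice the number of its blocks
    minus the number of blocks of nonzero weight, this bounds the length of a
    factorization from below by #|T| plus the number of cycles minus the value
    of the component partition.  By induction: a new edge either joins two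
    components, hence two cycles, or leaves the components unchanged and
    creates at most one cycle; a new diagonal entry changes the weight of one
    component. *)
Lemma refls_bound s : refls s ->
  #|T| + ncycles (prods s) + nnonzero (comp s) (prods s).2
    <= size s + (nlabels (comp s)).*2.
Proof.
elim: s => [_|t s IHs /refls_cons[rt rs]].
  rewrite /prods big_nil cyc1 //= /nlabels imset_id cardsT -addnn add0n.
  rewrite [nnonzero _ _](_ : _ = 0) ?addn0 // /nnonzero eq_card0 // => y.
  by rewrite inE /wt big1 ?eqxx // => x _; rewrite ffunE.
have {}IHs := IHs rs; have ks := comp_prods rs; rewrite prods_cons /=.
set g := prods s in IHs ks *; set f := comp s in IHs ks *.
case: rt => [i j c ij|i k _ _]; last first.
  rewrite -/(comp (diag1 i k :: s)) comp_diag1 -/f ncycles_diag1 addSn.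
  apply: leq_trans (_ : _ <= (#|T| + ncycles g + nnonzero f g.2).+1) _;
    last by [].
  rewrite -addnS leq_add2l;
    apply: (@nnonzero_change1 _ _ _ _ _ _ i) => x /negPf xi.
  by rewrite wrM2 ffunE xi add0r perm1.
rewrite -/(comp (swap i j c :: s)); set f' := comp (_ :: _).
have ff' : same_kernel f' (merge i j f) by apply: comp_swap.
rewrite (nlabels_same_kernel ff') (nnonzero_same_kernel _ ff').
have -> : nnonzero (merge i j f) (swap i j c * g).2 = nnonzero (merge i j f)
  g.2.
  apply: eq_nnonzero => y; rewrite wtM ?wt_swap ?add0r ?mergeLR //.
  exact/keeps_swap/mergeLR.
have C := ncycles_swap c g ij.
have [E|N] := eqVneq (f i) (f j).
  have S : same_kernel (merge i j f) f by move=> x y; rewrite !merge_eq.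
  rewrite (nlabels_same_kernel S) (nnonzero_same_kernel _ S);
    apply: leq_trans (_ : _ <= (#|T| + ncycles g + nnonzero f g.2).+1) _ => //.
  rewrite -addSn -addnS leq_add2r leq_add2l -C; exact: leq_addr.
have F : i \notin porbit g.1 j.
  by apply: contra N => /(keeps_porbit ks)->.
move: IHs C; rewrite F (nlabels_merge N) => IHs C.
rewrite addn2 in C; have := nnonzero_merge i j f g.2;
  move: IHs C. move: (nnonzero _ _) (nnonzero _ _) (nlabels _) (ncycles _) =>
    a b l d.
by move: (ncycles _) #|T|; lia.
Qed.

End Reflections.

(** * Bringing a prescribed reflection to the front *)

Section First.
Variables (T : finType) (A : zmodType) (K : A -> bool).
Local Notation W := (wreath T A).
Local Notation refls := (@refls T A K).
Implicit Types (i j x y : T) (k c : A) (g t w : W) (s p q : seq W).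

Lemma mem_first s s' t : hurwitz s s' -> t \in s' ->
  exists s1, hurwitz s (t :: s1).
Proof.
move=> ss' ts'; case/splitPr: ts' ss' => p q ss'.
by eexists; apply: hurwitz_trans ss' (hurwitz_front _ _ _).
Qed.

(** The edge between a and b connects the component of i to that of j.  It is
    dragged to an edge between i and b by an edge between a and i, and then to
    one between i and j by an edge between b and j. *)
Lemma swap_first_step n s a b i j c :
    (forall s, size s <= n -> refls s -> forall i j, i != j ->
       comp s i = comp s j -> exists c s1, hurwitz s (swap i j c :: s1)) ->
    size s <= n -> refls s -> a != b ->
    comp s a = comp s i -> comp s b = comp s j -> comp s i != comp s j ->
  exists c' s1, hurwitz (swap a b c :: s) (swap i j c' :: s1).
Proof.
move=> IH sn rs ab fai fbj fij.
have nbi : b != i by apply: contraNneq fij => <-; rewrite fbj.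
have nij : i != j by apply: contraNneq fij => ->.
have [c' [p [s1 [H1 rs1 ss1 E1]]]] : exists c' p s1,
    [/\ hurwitz (swap a b c :: s) (p ++ swap i b c' :: s1), refls s1,
      size s1 <= n
      & comp s1 b = comp s1 j].
  have [ai|nai] := eqVneq a i.
    by exists c, [::], s; rewrite -ai; split=> //; apply: hurwitz_refl.
  have [x [s1 H]] := IH s sn rs a i nai fai.
  have /refls_cons[_ rs1] : refls (swap a i x :: s1) by apply/(hurwitz_refls K
    H).
  exists (c - (swap a i x).2 a + (swap a i x).2 b)%R, [:: swap a i x], s1;
    split=> //.
  - apply: hurwitz_trans (hurwitz_cons _ H) _.
    have := hurwitz_step [::] s1 (swap a b c) (swap a i x).
    by rewrite swapJ // /= tpermL tpermD // eq_sym.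
  - by move/hurwitz_size: H sn => -> /ltnW.
  - have S := same_kernel_trans (hurwitz_comp rs H) (comp_swap x s1 nai).
    have /(same_kernelP _ _ S) := fbj.
    have M y : comp s y != comp s a -> comp s1 y != comp s1 a.
      apply: contraNneq => E; apply/eqP/(same_kernelP _ _ S);
        exact: merge_coarse.
    by rewrite /merge !ifN //; apply: M; rewrite fai ?fbj eq_sym.
have [bj|nbj] := eqVneq b j.
  have [|s2 H2] := mem_first (t := swap i b c') H1.
    by rewrite mem_cat mem_head orbT.
  by exists c', s2; rewrite -bj.
have [y [s2 H2]] := IH s1 ss1 rs1 b j nbj E1.
have H3 := hurwitz_trans H1 (hurwitz_catl p (hurwitz_cons _ H2)).
have := hurwitz_trans H3 (hurwitz_step p s2 (swap i b c') (swap b j y)).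
rewrite swapJ 1?eq_sym //= tpermL tpermD // 1?eq_sym // => H4.
set c2 := (X in swap i j X) in H4.
have [|s3 H5] := mem_first (t := swap i j c2) H4.
  by rewrite mem_cat !inE eqxx !orbT.
by exists c2, s3.
Qed.

(** Conjugating an edge by an adjacent one short-cuts the path they form, so
    Hurwitz moves can contract a path from i to j to a single edge. *)
Lemma swap_first s i j : refls s -> i != j -> comp s i = comp s j ->
  exists c s1, hurwitz s (swap i j c :: s1).
Proof.
move: {2}(size s) (leqnn (size s)) => n; elim: n s i j => [|n IHn] s i j.
  by rewrite leqn0 size_eq0 => /eqP-> _ /negPf ij /= /eqP; rewrite ij.
case: s => [_ _ /negPf ij /= /eqP|t s]; first by rewrite ij.
rewrite ltnS => sn /refls_cons[rt rs] ij.
have IH s0 : size s0 <= n -> refls s0 -> forall i j, i != j ->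
    comp s0 i = comp s0 j -> exists c s1, hurwitz s0 (swap i j c :: s1).
  by move=> ? ? ? ? ? ?; apply: IHn.
have easy : comp s i = comp s j ->
    exists c s1, hurwitz (t :: s) (swap i j c :: s1).
  move=> E; have [c [s1 H]] := IH s sn rs i j ij E.
  have [|s2 H2] := mem_first (t := swap i j c) (hurwitz_cons t H).
    by rewrite !inE eqxx orbT.
  by exists c, s2.
case: rt easy => [a b c ab|a k _ _] easy; last by rewrite comp_diag1.
move/(same_kernelP _ _ (comp_swap c s ab)).
have [/easy//|fij] := eqVneq (comp s i) (comp s j).
rewrite /merge; case: eqP => fia; case: eqP => fja E.
- by rewrite fia fja eqxx in fij.
- exact: (swap_first_step _ IH sn rs ab).
- by rewrite swapC //; apply: (swap_first_step _ IH sn rs _); rewrite // eq_sym.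
- by rewrite E eqxx in fij.
Qed.

Lemma wt_prods (L : finType) (f : T -> L) s (y : L) :
    (forall t, t \in s -> keeps f t /\ wt f t.2 y = 0%R) ->
  wt f (prods s).2 y = 0%R.
Proof.
elim: s => [|t s IHs] H.
  by rewrite /prods big_nil /wt big1 // => x _; rewrite ffunE.
rewrite prods_cons wtM; last by have [] := H t (mem_head _ _).
have [_ ->] := H t (mem_head _ _); rewrite add0r; apply: IHs => x xs.
by apply: H; rewrite inE xs orbT.
Qed.

(** Edges contribute nothing to the weight of a component, so one of nonzero
    weight contains a diagonal reflection; conjugation by an edge then moves
    it to the desired point. *)
Lemma diag1_first s i : refls s -> wt (comp s) (prods s).2 (comp s i) != 0%R ->
  exists k s1, hurwitz s (diag1 i k :: s1).
Proof.
move=> rs nz0; have [l [k [ls li]]] :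
    exists l k, diag1 l k \in s /\ comp s l = comp s i.
  case: (boolP (has (fun t => [exists l,
      (t == diag1 l (t.2 l)) && (comp s l == comp s i)]) s)).
    case/hasP=> t ts /existsP[l /andP[/eqP E /eqP li]].
    by exists l, (t.2 l); rewrite -E.
  move/hasPn=> H; case/eqP: nz0; apply: wt_prods => t ts.
  split; first exact: (comp_keeps rs ts).
  move: (H t ts) (comp_keeps rs ts);
    case: (rs t ts) => [a b c ab _|l k _ _ Hl _].
    by move/keeps_swap => fab; apply: wt_swap.
  rewrite wt_diag1; case: eqP => // li; case/negP: Hl.
  by apply/existsP; exists l; rewrite ffunE eqxx li !eqxx.
have [s1 H1] := mem_first (hurwitz_refl s) ls.
have [<-|nli] := eqVneq l i; first by exists k, s1.
have /refls_cons[_ rs1] : refls (diag1 l k :: s1) by apply/(hurwitz_refls K H1).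
have E1 : comp s1 l = comp s1 i.
  by rewrite -(comp_diag1 l k); apply/(same_kernelP _ _ (hurwitz_comp rs H1)).
have [c [s2 H2]] := swap_first rs1 nli E1.
have := hurwitz_trans (hurwitz_trans H1 (hurwitz_cons _ H2)) (hurwitz_step
  [::] s2 _ _).
rewrite diag1J /= tpermL => H3; exists k.
by apply: mem_first H3 _; rewrite !inE eqxx orbT.
Qed.

End First.

(** * Tight factorizations *)

Section Tight.
Variables (T : finType) (A : zmodType) (K : A -> bool).
Local Notation W := (wreath T A).
Local Notation refls := (@refls T A K).
Implicit Types (i j x y : T) (k c : A) (g t w : W) (s p q : seq W).
Implicit Types (h : {ffun T -> A}).

(** Equality in the bound on the length given by the components. *)
Definition tight s : Prop :=
  size s + (nlabels (comp s)).*2 = #|T| + ncycles (prods s) + nnonzero (comp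
    s) (prods s).2.

Lemma hurwitz_tight s s' : refls s -> hurwitz s s' -> tight s <-> tight s'.
Proof.
move=> rs ss'; have S := hurwitz_comp rs ss'.
by rewrite /tight (hurwitz_size ss') (hurwitz_prods ss') (nlabels_same_kernel
  S) (nnonzero_same_kernel _ S).
Qed.

Definition diag h : W := wr 1 h.
Definition conj_diag h s := [seq t ^ diag h | t <- s].

Lemma diagD h h' : diag (h + h')%R = diag h * diag h'.
Proof.
by apply: wr_eq => [|x]; rewrite ?wrM1 ?mul1g // wrM2 /= perm1 ffunE.
Qed.

Lemma conj_diagD h h' s : conj_diag (h + h')%R s = conj_diag h' (conj_diag h s).
Proof. by rewrite /conj_diag -map_comp; apply: eq_map => t;
  rewrite diagD /= conjgM. Qed.

Lemma swap_diag h i j c :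
  i != j -> swap i j c ^ diag h = swap i j (c - h i + h j)%R.
Proof. by move=> ij; rewrite swapJ //= !perm1. Qed.

Lemma diag1_diag h i k : diag1 i k ^ diag h = diag1 i k.
Proof. by rewrite diag1J /= perm1. Qed.

Lemma keeps_diag h g : keeps h g -> g ^ diag h = g.
Proof.
move=> hg; apply: wr_eq => [|x]; first by rewrite wrJ1 conjg1.
by rewrite -{1}[x](perm1 x) wrJ2 /= hg addrNK.
Qed.

Lemma conj_diag0 s : conj_diag 0%R s = s.
Proof.
rewrite /conj_diag -[RHS]map_id; apply: eq_map => t.
by apply: keeps_diag => x; rewrite !ffunE.
Qed.

Lemma comp_conj_diag h s : comp (conj_diag h s) = comp s.
Proof.
elim: s => // t s IHs; rewrite -[conj_diag h _]/(t ^ diag h :: conj_diag h s).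
rewrite [LHS](_ : _ = if [pick x | (t ^ diag h).1 x != x] is Some x then
  merge x ((t ^ diag h).1 x) (comp (conj_diag h s)) else comp (conj_diag h s))
    //.
by rewrite wrJ1 conjg1 IHs.
Qed.

Lemma conj_diag_id h s : refls s ->
  (forall x y, comp s x = comp s y -> h x = h y) -> conj_diag h s = s.
Proof.
move=> rs H; rewrite /conj_diag -[RHS]map_id; apply/eq_in_map => t ts /=.
case: (rs t ts) (comp_keeps rs ts) => [i j c ij /keeps_swap E|i k _ _ _].
  by rewrite swap_diag // (H i j E) addrNK.
exact: diag1_diag.
Qed.

Lemma porbit_tperm (u : {perm T}) i j : i != j -> i \notin porbit u j ->
  i \in porbit (tperm i j * u) j.
Proof.
move=> ij H; have := porbits_mul_tperm u i j.
have := porbits_mul_tperm (tperm i j * u) i j.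
rewrite /= mulgA tperm2 mul1g ij H; case: (i \in _) => //=; lia.
Qed.

(** In a tight factorization each component carries at most one diagonal
    entry, which therefore accounts for the whole weight of the component:
    otherwise the rest of the factorization would be too short. *)
Lemma tight_diag1 i k s : refls (diag1 i k :: s) -> tight (diag1 i k :: s) ->
  tight s /\ k = wt (comp s) (prods (diag1 i k :: s)).2 (comp s i).
Proof.
move=> /refls_cons[_ rs]; rewrite /tight comp_diag1 prods_cons ncycles_diag1 /=.
have := refls_bound rs; have ks := comp_prods rs.
set g := prods s in ks *; set f := comp s in ks *.
have : nnonzero f (diag1 i k * g).2 <= (nnonzero f g.2).+1.
  apply: (@nnonzero_change1 _ _ _ _ _ _ i) => x /negPf xi.
  by rewrite wrM2 ffunE xi add0r perm1.
have wE y : wt f (diag1 i k * g).2 y = ((if y == f i then k else 0) + wt f g.2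
  y)%R.
  by rewrite wtM ?wt_diag1 //; apply: keeps_diag1.
move=> le1 bound E.
have E2 : nnonzero f (diag1 i k * g).2 = (nnonzero f g.2).+1.
  move: le1 bound E; move: (nnonzero _ _) (nnonzero _ _) (nlabels _) (ncycles
    _) => a b l d.
  by move: #|T| (size s); lia.
split.
  by apply/eqP; rewrite -eqSS -addSn; apply/eqP; rewrite E E2 addnS.
rewrite wE eqxx; case: (eqVneq (wt f g.2 (f i)) 0%R) => [->|n1].
  by rewrite addr0.
(* otherwise the number of nonzero totals could not have increased *)
suff : nnonzero f (diag1 i k * g).2 <= nnonzero f g.2 by rewrite E2 ltnn.
apply/subset_leq_card/subsetP=> y; rewrite !inE wE.
by case: (eqVneq y (f i)) => [->|_]; rewrite ?add0r.
Qed.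

(** Removing an edge between two cycles of a component merges these cycles and
    keeps the component connected. *)
Lemma tight_swap_join i j c s : i != j -> refls (swap i j c :: s) ->
    tight (swap i j c :: s) ->
    i \notin porbit (prods (swap i j c :: s)).1 j ->
  [/\ tight s, same_kernel (comp (swap i j c :: s)) (comp s) &
      i \in porbit (prods s).1 j].
Proof.
move=> ij /refls_cons[_ rs] + H.
have Hi : i \in porbit (prods s).1 j.
  have := porbit_tperm ij H; rewrite prods_cons wrM1 /= mulgA tperm2 mul1g.
  by [].
have ks := comp_prods rs; have E := keeps_porbit ks Hi.
have S : same_kernel (comp (swap i j c :: s)) (comp s).
  by apply: same_kernel_trans (comp_swap c s ij) _ => x y; rewrite !merge_eq.
rewrite /tight (nlabels_same_kernel S) (nnonzero_same_kernel _ S) prods_cons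
  => t0.
split=> //; have := ncycles_swap c (prods s) ij; rewrite Hi addn0.
have <- : nnonzero (comp s) (swap i j c * prods s).2 = nnonzero (comp s)
  (prods s).2.
  by apply: eq_nnonzero => y; rewrite wtM ?wt_swap ?add0r //; apply/keeps_swap.
move: t0 => /=; move: (nnonzero _ _) (nlabels _) (ncycles _) => a l d.
by move: (ncycles _) #|T| (size s); lia.
Qed.

(** Removing an edge between two points of a cycle splits the cycle; were the
    component still connected, what is left would be too short. *)
Lemma tight_swap_cut i j c s (g := prods (swap i j c :: s)) :
    i != j -> refls (swap i j c :: s) -> tight (swap i j c :: s) ->
    i \in porbit g.1 j -> nnonzero (comp (swap i j c :: s)) g.2 = 0 ->
  [/\ tight s, comp s i != comp s j & nnonzero (comp s) (prods s).2 = 0].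
Proof.
move=> ij /refls_cons[_ rs] + H nz0; rewrite /tight nz0 /=.
have C : ncycles (prods s) = (ncycles g).+1.
  have <- : ncycles (swap i j 0 * g) = ncycles (prods s).
    by rewrite /ncycles /g prods_cons !wrM1 /= mulgA tperm2 mul1g.
  by have := ncycles_swap 0 g ij; rewrite H addn0.
have S := comp_swap c s ij; have B := refls_bound rs.
rewrite (nlabels_same_kernel S); have [E|N] := eqVneq (comp s i) (comp s j).
  have S' : same_kernel (merge i j (comp s)) (comp s).
    by move=> x y; rewrite !merge_eq.
  rewrite (nlabels_same_kernel S') => t0; exfalso; move: t0 B; rewrite -/g C.
  by move: (nnonzero _ _) (ncycles _) (nlabels _) => a b l;
    move: #|T| (size s); lia.
rewrite -/g => t0; move: B; rewrite C (nlabels_merge N) => B.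
have N0 : nnonzero (comp s) (prods s).2 = 0.
  move: t0 B; move: (nnonzero _ _) (ncycles _) (nlabels _) => a b l.
  by move: #|T| (size s); lia.
split=> //; rewrite N0; move: t0; move: (ncycles _) (nlabels _) => b l.
by move: #|T| (size s); lia.
Qed.

End Tight.

(** * Tight factorizations are equivalent up to diagonal conjugation *)

Section Conj.
Variables (T : finType) (A : zmodType) (K : A -> bool).
Local Notation W := (wreath T A).
Local Notation refls := (@refls T A K).
Implicit Types (i j x y : T) (k c : A) (g t w : W) (s p q : seq W).
Implicit Types (h : {ffun T -> A}).

Lemma prods_inj t s s' : prods (t :: s) = prods (t :: s') -> prods s = prods s'.
Proof. by rewrite !prods_cons => /mulgI. Qed.

Definition unicyclic s : Prop :=
  forall x y, comp s x = comp s y -> y \in porbit (prods s).1 x.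

(** When every component is a single cycle and has weight zero, the edge
    joining a point i to its predecessor has a forced weight and its removal
    isolates i. *)
Lemma isolate s i (j := (prods s).1^-1 i) c s1 :
    refls s -> tight s -> nnonzero (comp s) (prods s).2 = 0 -> unicyclic s ->
    i != j -> hurwitz s (swap i j c :: s1) ->
  [/\ tight s1, same_kernel (comp s1) (refine [set i] (comp s)),
      c = (- (prods s).2 j)%R &
      forall h, keeps h (prods s1) -> conj_diag h s1 = s1].
Proof.
move=> rs ts nz0 cyc1 ij H; set g := prods s in j nz0 ij H *.
have rt : refls (swap i j c :: s1) by apply/(hurwitz_refls K H).
have rs1 : refls s1 by case/refls_cons: rt.
have tt : tight (swap i j c :: s1) by apply/(hurwitz_tight rs H).
have S := hurwitz_comp rs H; have gE : prods (swap i j c :: s1) = g.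
  by rewrite -(hurwitz_prods H).
have gj : g.1 j = i by rewrite permKV.
have [|| ts1 N nz1] := tight_swap_cut ij rt tt.
- by rewrite gE -{1}gj (mem_porbit g.1 1).
- by rewrite -(nnonzero_same_kernel _ S) gE.
have g1E z : g.1 z = (prods s1).1 (tperm i j z).
  by rewrite -gE prods_cons wrM1 permM.
(* giving i the label of j turns a labeling kept by the product of s1 into
   one kept by g, which is then constant on the components of s *)
have star X (h : T -> X) : keeps h (prods s1) ->
    forall x y, x != i -> y != i -> comp s x = comp s y -> h x = h y.
  move=> hg x y xi yi E; pose h' z := if z == i then h j else h z.
  have kh : keeps h' g.
    move=> z; have [-> {z}|zi] := eqVneq z i.
      have gi : g.1 i != i.
        by rewrite -{2}gj (inj_eq perm_inj).
      by rewrite /h' (negPf gi) eqxx g1E tpermL hg.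
    have [-> {z zi}|zj] := eqVneq z j.
      by rewrite gj /h' eqxx eq_sym (negPf ij).
    have gz : g.1 z != i by rewrite -gj (inj_eq perm_inj).
    by rewrite /h' (negPf gz) (negPf zi) g1E tpermD 1?eq_sym // hg.
  have := keeps_porbit kh (cyc1 _ _ E).
  by rewrite /h' (negPf xi) (negPf yi) => ->.
have k1 := comp_prods rs1; have S1 := comp_swap c s1 ij.
have coarse x y : comp s1 x = comp s1 y -> comp s x = comp s y.
  by move=> E; apply/(same_kernelP _ _ S)/(same_kernelP _ _ S1)/merge_coarse.
have cij : comp s i = comp s j.
  by apply/(same_kernelP _ _ S)/(same_kernelP _ _ S1)/mergeLR.
have only_i x : comp s1 x = comp s1 i -> x = i.
  move=> E; apply/eqP; apply: contraNT N => xi.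
  rewrite -E; apply/eqP; apply: (star _ _ k1) => //; first by rewrite eq_sym.
  by rewrite -cij; apply: coarse.
split=> //.
- move=> x y; rewrite /refine xpair_eqE !inE; apply/eqP/andP.
    move=> E; split; last exact/eqP/coarse.
    have [xi|xi] := eqVneq x i.
      by move: E; rewrite xi => /esym/only_i->; rewrite eqxx.
    apply/eqP/esym/negbTE; apply: contraNneq xi => yi.
    by apply/eqP/only_i; rewrite E yi.
  case=> /eqP Exy /eqP /(star _ _ k1 x y); have [xi|nxi] := eqVneq x i.
    by move: Exy; rewrite xi eqxx => /esym/eqP->.
  by move: Exy; rewrite (negPf nxi) => /esym/negbT yi; apply.
- have := nnonzero0P nz1 (comp s1 i); rewrite /wt (big_pred1 i); last first.
    by move=> x; apply/eqP/eqP => [/only_i|->].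
  move=> E; have := congr1 (fun w : W => w.2 j) gE.
  rewrite prods_cons wrM2 /= tpermR E !ffunE eq_sym (negPf ij) eqxx addr0.
  by move=> <-; rewrite opprK.
- move=> h hk; apply: (conj_diag_id rs1) => x y E.
  have [xi|xi] := eqVneq x i; first by rewrite xi in E *; rewrite (only_i y).
  have [yi|yi] := eqVneq y i; first by rewrite yi in E *; rewrite (only_i x).
  by apply: (star _ _ hk) => //; apply: coarse.
Qed.

(** Both factorizations are brought to begin with the same reflection, which
    is then removed.  In a component of nonzero weight this is the diagonal
    reflection at a chosen point.  When a component contains several cycles,
    it is an edge between two of them, whose weights in the two factorizations
    are made equal by a conjugation supported on one cycle.  In the remaining
    case the edge at a point i has a forced weight. *)
Lemma tight_conj s s' : refls s -> refls s' -> prods s = prods s' ->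
    same_kernel (comp s) (comp s') -> tight s -> tight s' ->
  exists h, keeps h (prods s) /\ hurwitz s' (conj_diag h s).
Proof.
move: {2}(size s) (leqnn (size s)) => n.
elim: n s s' => [|n IHn] s s' sn rs rs' gE S ts ts'.
  have ss : size s' = size s.
    move: ts ts'; rewrite /tight -gE (nlabels_same_kernel S)
      (nnonzero_same_kernel _ S) => <-.
    by move/eqP; rewrite eqn_add2r => /eqP.
  move: sn ss; rewrite leqn0 size_eq0 => /eqP-> /size0nil->; exists 0%R.
  by rewrite conj_diag0; split; [move=> x;
    rewrite !ffunE | apply: hurwitz_refl].
have peel t s1 : hurwitz s (t :: s1) -> size s1 <= n.
  by move/hurwitz_size=> E; move: sn; rewrite E.
set g := prods s in gE *.
have [nz0|/nnonzero_gt0P[i ni]] := eqVneq (nnonzero (comp s) g.2) 0; last first.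
  have [k [s1 H1]] := diag1_first rs ni.
  have [k' [s1' H1']] : exists k s1, hurwitz s' (diag1 i k :: s1).
    by apply: (diag1_first rs'); rewrite -gE -(wt_same_kernel _ _ S).
  have rt : refls (diag1 i k :: s1) by apply/(hurwitz_refls K H1).
  have rt' : refls (diag1 i k' :: s1') by apply/(hurwitz_refls K H1').
  have [ts1 kE] := tight_diag1 rt ((hurwitz_tight rs H1).1 ts).
  have [ts1' kE'] := tight_diag1 rt' ((hurwitz_tight rs' H1').1 ts').
  have S1 : same_kernel (comp s1) (comp s1').
    rewrite -(comp_diag1 i k s1) -(comp_diag1 i k' s1').
    exact: same_kernel_trans (same_kernel_sym (hurwitz_comp rs H1))
      (same_kernel_trans S (hurwitz_comp rs' H1')).
  have P : prods (diag1 i k :: s1) = prods (diag1 i k' :: s1').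
    by rewrite -(hurwitz_prods H1) -(hurwitz_prods H1').
  have kk : k = k' by rewrite kE kE' P (wt_same_kernel _ _ S1).
  have [_ rs1] := (refls_cons K _ _).1 rt.
  have [_ rs1'] := (refls_cons K _ _).1 rt'.
  have P1 : prods s1 = prods s1' by apply: (@prods_inj (diag1 i k));
    rewrite {2}kk.
  have [h [kh Hh]] := IHn s1 s1' (peel _ _ H1) rs1 rs1' P1 S1 ts1 ts1'.
  exists h; split.
    rewrite /g (hurwitz_prods H1) prods_cons; apply: keepsM kh;
      exact: keeps_diag1.
  apply: hurwitz_trans H1' _; rewrite -kk;
    apply: hurwitz_trans (hurwitz_cons _ Hh) _.
  rewrite -{1}(diag1_diag h i k); exact: hurwitz_conj (hurwitz_sym H1).
have [/existsP[i /existsP[j /andP[/eqP cij nij]]]|] :=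
  boolP [exists i, exists j, (comp s i == comp s j) && (i \notin porbit g.1 j)].
  have ij : i != j by apply: contraNneq nij => ->; apply: porbit_id.
  have [c [s1 H1]] := swap_first rs ij cij.
  have [c' [s1' H1']] : exists c s1, hurwitz s' (swap i j c :: s1).
    by apply: (swap_first rs' ij); apply/(same_kernelP _ _ S).
  (* rotate the cycle of i so that both factorizations start identically *)
  pose h1 : {ffun T -> A} :=
    [ffun z => if z \in porbit g.1 i then c - c' else 0]%R.
  have kh1 : keeps h1 g.
    move=> z; rewrite !ffunE -!eq_porbit_mem.
    by have := porbit_perm g.1 1 z; rewrite expg1 => ->.
  have h1i : h1 i = (c - c')%R by rewrite ffunE porbit_id.
  have h1j : h1 j = 0%R by rewrite ffunE porbit_sym (negPf nij).
  pose s2 := conj_diag h1 s1.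
  have E2 : conj_diag h1 (swap i j c :: s1) = swap i j c' :: s2.
    by rewrite /= swap_diag // h1i h1j addr0 subKr.
  have rt : refls (swap i j c :: s1) by apply/(hurwitz_refls K H1).
  have rt2 : refls (swap i j c' :: s2) by rewrite -E2; apply: refls_conj.
  have rt' : refls (swap i j c' :: s1') by apply/(hurwitz_refls K H1').
  have P2 : prods (swap i j c' :: s2) = g.
    by rewrite -E2 prods_conj -(hurwitz_prods H1) keeps_diag.
  have P' : prods (swap i j c' :: s1') = g by rewrite -(hurwitz_prods H1').
  have C2 : same_kernel (comp s) (comp (swap i j c' :: s2)).
    by rewrite -E2 comp_conj_diag; apply: (hurwitz_comp rs H1).
  have t2 : tight (swap i j c' :: s2).
    move: ts; rewrite /tight -/g P2 (nlabels_same_kernel C2)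
      (nnonzero_same_kernel _ C2) => <-.
    by rewrite (hurwitz_size H1) /= size_map.
  have n2 : i \notin porbit (prods (swap i j c' :: s2)).1 j by rewrite P2.
  have n' : i \notin porbit (prods (swap i j c' :: s1')).1 j by rewrite P'.
  have [ts2 S2 i2] := tight_swap_join ij rt2 t2 n2.
  have [ts1' S1' _] := tight_swap_join ij rt' ((hurwitz_tight rs' H1').1 ts')
    n'.
  have sz2 : size s2 <= n by rewrite size_map; apply: peel H1.
  have [_ rs2] := (refls_cons K _ _).1 rt2.
  have [_ rs1'] := (refls_cons K _ _).1 rt'.
  have P1 : prods s2 = prods s1' by apply: (@prods_inj (swap i j c'));
    rewrite P2.
  have S21 : same_kernel (comp s2) (comp s1').
    apply: same_kernel_trans (same_kernel_sym S2) (same_kernel_trans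
      (same_kernel_sym C2) _).
    exact: same_kernel_trans S (same_kernel_trans (hurwitz_comp rs' H1') S1').
  have [h2 [kh2 Hh2]] := IHn s2 s1' sz2 rs2 rs1' P1 S21 ts2 ts1'.
  have h2ij : h2 i = h2 j := keeps_porbit kh2 i2.
  exists (h1 + h2)%R; split.
    have kg2 : keeps h2 g.
      by rewrite -P2 prods_cons; apply: keepsM kh2; apply/keeps_swap.
    by move=> x; rewrite ffunE kh1 kg2 [RHS]ffunE.
  apply: hurwitz_trans H1' _; apply: hurwitz_trans (hurwitz_cons _ Hh2) _.
  rewrite conj_diagD; have ->
    : swap i j c' :: conj_diag h2 s2 = conj_diag h2 (swap i j c' :: s2).
    by rewrite /= swap_diag // h2ij addrNK.
  by apply: hurwitz_conj; rewrite -E2; apply: hurwitz_conj; apply: hurwitz_sym.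
rewrite negb_exists => /forallP H.
have oc : unicyclic s.
  move=> x y E; move: (H y); rewrite negb_exists => /forallP/(_ x).
  by rewrite E eqxx negbK.
case: (pickP (fun i => g.1^-1 i != i)) => [i ij|fixed]; last first.
  have sz0 s0 : prods s0 = g -> tight s0 ->
    same_kernel (comp s) (comp s0) -> s0 = [::].
    move=> P0 + S0; rewrite /tight P0 -(nnonzero_same_kernel _ S0) nz0
      -(nlabels_same_kernel S0).
    have g1 : g.1 = 1.
      by apply/permP=> x; rewrite perm1 -{1}(eqP (negbFE (fixed x))) permKV.
    rewrite (cyc1 g1) /nlabels card_imset ?cardsT -?addnn ?addn0.
      by move/eqP; rewrite -[X in _ == X]add0n eqn_add2r => /eqP/size0nil.
    by move=> x y /oc; rewrite -/g g1 => /porbitP[m ->]; rewrite expg1n perm1.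
  have -> : s = [::] by apply: sz0.
  have -> : s' = [::] by apply: sz0.
  by exists 0%R; split; [move=> x; rewrite !ffunE | apply: hurwitz_refl].
have ij' : i != (prods s).1^-1 i by rewrite eq_sym.
have cij : comp s i = comp s ((prods s).1^-1 i).
  by rewrite -[X in comp s X = _](permKV (prods s).1) (comp_prods rs).
have oc' : unicyclic s'.
  by move=> x y; rewrite -(same_kernelP _ _ S) -gE; apply: oc.
have ij2 : i != (prods s').1^-1 i by rewrite -gE.
have cij' : comp s' i = comp s' ((prods s').1^-1 i).
  by rewrite -gE; apply/(same_kernelP _ _ S).
have nz0' : nnonzero (comp s') (prods s').2 = 0 by rewrite -gE
  -(nnonzero_same_kernel _ S).
have [c [s1 H1]] := swap_first rs ij' cij.
have [c' [s1' H1']] := swap_first rs' ij2 cij'.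
have [ts1 S1 cE inv] := isolate rs ts nz0 oc ij' H1.
have [ts1' S1' cE' inv'] := isolate rs' ts' nz0' oc' ij2 H1'.
rewrite -gE in cE' H1'; have cc : c' = c by rewrite cE cE'.
rewrite cc in H1' => {cE' cE}.
have /refls_cons[_ rs1] : refls (swap i (g.1^-1 i) c :: s1).
  by apply/(hurwitz_refls K H1).
have /refls_cons[_ rs1'] : refls (swap i (g.1^-1 i) c :: s1').
  by apply/(hurwitz_refls K H1').
have P1 : prods s1 = prods s1'.
  apply: (@prods_inj (swap i (g.1^-1 i) c)).
  by rewrite -(hurwitz_prods H1) -(hurwitz_prods H1').
have S11 : same_kernel (comp s1) (comp s1').
  apply: same_kernel_trans S1 (same_kernel_trans _ (same_kernel_sym S1')) => x
    y.
  by rewrite /refine !xpair_eqE S.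
have [h [kh Hh]] := IHn s1 s1' (peel _ _ H1) rs1 rs1' P1 S11 ts1 ts1'.
exists 0%R; split; first by move=> x; rewrite !ffunE.
rewrite conj_diag0; apply: hurwitz_trans H1' (hurwitz_trans (hurwitz_cons _
  Hh) _).
by rewrite inv //; apply: hurwitz_sym.
Qed.

End Conj.

(** * Existence of tight factorizations *)

Section ParallelEdges.
Variables (T : finType) (A : zmodType) (K : A -> bool).
Local Notation W := (wreath T A).
Local Notation refls := (@refls T A K).
Implicit Types (i j x y : T) (k c : A) (g t w : W) (s p q : seq W).

Lemma swap_sq i j c : i != j -> swap i j c * swap i j c = 1.
Proof.
move=> ij; apply: wr_eq => [|x]; first by rewrite wrM1 /= tperm2.
rewrite wrM2 !ffunE /=; case: tpermP => [->|->|/eqP/negPf-> /eqP/negPf->].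
- by rewrite !eqxx eq_sym (negPf ij) subrr.
- by rewrite !eqxx eq_sym (negPf ij) addNr.
- by rewrite addr0.
Qed.

Lemma nlabels_le (L : finType) (f : T -> L) : nlabels f <= #|T|.
Proof. by rewrite /nlabels -cardsT leq_imset_card. Qed.

Variables (L : finType) (f : T -> L) (g : W) (S : {set T}) (i j : T).
Hypotheses (fg : keeps f g) (Sg : forall x, (g.1 x \in S) = (x \in S)).
Hypotheses (iS : i \in S) (jS : j \notin S) (fij : f i = f j).
Hypothesis Sf : forall x, x \in S -> f x = f i.

Let c := (- \sum_(x in S) g.2 x)%R.
(** Removing two parallel edges whose weights differ by the total of S leaves
    an element for which S has weight zero and can be split off. *)
Definition unpair : W := swap i j c * (swap i j 0 * g).

Let ij : i != j. Proof. by apply: contraNneq jS => <-. Qed.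

Lemma unpair1 : unpair.1 = g.1.
Proof. by rewrite !wrM1 /= mulgA tperm2 mul1g. Qed.

Lemma unpair2 x :
  unpair.2 x = (g.2 x + (if x == i then c else if x == j then - c else 0))%R.
Proof.
have z0 y : (swap i j 0).2 y = 0%R by rewrite ffunE oppr0 !if_same.
by rewrite wrM2 wrM2 z0 add0r addrC /= tpermK ffunE.
Qed.

Lemma unpair_keeps : keeps (refine S f) unpair.
Proof. by move=> x; rewrite unpair1 /refine Sg fg. Qed.

Lemma unpair_sum : (\sum_(x in S) unpair.2 x)%R = 0%R.
Proof.
under eq_bigr do rewrite unpair2.
rewrite big_split /= [X in (_ + X)%R](_ : _ = c) ?subrr //.
rewrite (bigD1 i) //= eqxx big1 ?addr0 // => x /andP[xS /negPf->].
by case: eqP => // xj; rewrite xj (negPf jS) in xS.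
Qed.

Lemma unpair_wt : wt f unpair.2 =1 wt f g.2.
Proof.
have k0 b : keeps f (swap i j b) by apply/keeps_swap.
by move=> y; rewrite !wtM ?wt_swap ?add0r.
Qed.

Lemma pair_tight s : refls s -> prods s = unpair ->
    same_kernel (comp s) (refine S f) -> tight s ->
  let s' := [:: swap i j 0, swap i j c & s] in
  [/\ refls s', prods s' = g, same_kernel (comp s') f & tight s'].
Proof.
move=> rs gE S1 ts s'.
have P : prods s' = g.
  by rewrite !prods_cons gE /unpair !mulgA -(mulgA (swap i j 0)) swap_sq //
    mulg1 swap_sq // mul1g.
have S2 : same_kernel (comp s') f.
  apply: same_kernel_trans (comp_swap _ _ ij) _.
  have M := same_kernel_trans (comp_swap c s ij) (merge_refine iS jS fij Sf S1).
  apply: same_kernel_trans (merge_same_kernel i j M) _ => x y.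
  by rewrite !merge_eq.
split=> //.
  by apply/refls_cons; split; [|apply/refls_cons; split]; rewrite //;
    apply: ReflSwap.
move: ts; rewrite /tight P gE (nlabels_same_kernel S2) (nnonzero_same_kernel _
  S2) (nlabels_same_kernel S1).
rewrite (nnonzero_same_kernel _ S1) (nlabels_refine iS jS fij Sf)
  (nnonzero_refine Sf) ?unpair_sum //.
rewrite (eq_nnonzero unpair_wt) /ncycles unpair1 /= => <-.
by rewrite doubleS !addnS !addSn.
Qed.

End ParallelEdges.

Section Exist.
Variables (T : finType) (A : zmodType) (K : A -> bool).
Local Notation W := (wreath T A).
Local Notation refls := (@refls T A K).
Implicit Types (i j x y : T) (k c : A) (g t w : W) (s p q : seq W).
Hypothesis K0 : K 0%R.

Variables (N : A -> bool) (Z : {set T}).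
Hypotheses (N0 : N 0%R) (NB : forall a b, N a -> N b -> N (a - b)%R).

(** Conjugating by the diagonal element with entries d puts the entries of t
    lying over Z into N. *)
Definition compatible (d : T -> A) t : Prop :=
  forall x, x \in Z -> N (t.2 x - d x + d (t.1 x))%R.

Definition stable_sums_in g : Prop :=
  forall S : {set T}, (forall x, (g.1 x \in S) = (x \in S)) -> S \subset Z ->
  N (\sum_(x in S) g.2 x)%R.

Let NN a : N a -> N (- a)%R.
Proof. by move=> Na; rewrite -sub0r; apply: NB. Qed.

Lemma stable_sums_in1 g : g.1 = 1 ->
  stable_sums_in g <-> forall x, x \in Z -> N (g.2 x).
Proof.
move=> g1; split=> [H x xZ|H S _ SZ].
  have := H [set x]; rewrite big_set1; apply; last by rewrite sub1set.
  by move=> z; rewrite g1 perm1.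
apply: (big_ind N) => // [a b Na Nb|x /(subsetP SZ)/H//].
by rewrite -[b]opprK; apply: NB => //; apply: NN.
Qed.

Lemma compatible_change1 d b i t : keeps (fun x =>
  x == i) t -> compatible d t ->
  compatible (fun x => if x == i then b else d x) t.
Proof.
move=> ki H x xZ; have := H x xZ; rewrite ki.
have [->|//] := eqVneq x i.
have ti : t.1 i = i by apply/eqP; rewrite (ki i).
by rewrite ti !addrNK.
Qed.

Lemma compatible_swap (d : T -> A) i j c : i != j ->
    (i \in Z -> N (c - d i + d j)%R) -> (i \in Z) = (j \in Z) ->
  compatible d (swap i j c).
Proof.
move=> ij H E x xZ /=; rewrite ffunE;
  case: tpermP => [xi|xj|/eqP/negPf-> /eqP/negPf->].
- by rewrite xi eqxx H // -xi.
- rewrite xj eqxx eq_sym (negPf ij) -opprD -[d i]opprK -opprD.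
  by apply: NN; rewrite addrAC H // E -xj.
- by rewrite sub0r addNr.
Qed.

Let good s (d : T -> A) (L : finType) (f : T -> L) g :=
  [/\ refls s, prods s = g, same_kernel (comp s) f, tight s &
      forall t, t \in s -> compatible d t].

(** One step of the construction: g is multiplied by one or two reflections
    so that a point splits off, or a nonzero total disappears, and the
    measure of the induction decreases.  The potential d found for the rest
    is adjusted at the point that was split off, where only the new edges can
    see the change. *)
Section Steps.
Variables (n : nat).
Hypothesis IH : forall (L : finType) (f : T -> L) g,
  (#|T| - nlabels f) + nnonzero f g.2 < n -> keeps f g ->
  (forall x y, f x = f y -> (x \in Z) = (y \in Z)) ->
  (forall y : L, K (wt f g.2 y)) -> stable_sums_in g ->
    exists s d, good s d f g.
Variables (L : finType) (f : T -> L) (g : W).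
Hypotheses (mu : (#|T| - nlabels f) + nnonzero f g.2 < n.+1) (fg : keeps f g).
Hypothesis fZ : forall x y, f x = f y -> (x \in Z) = (y \in Z).
Hypotheses (Kf : forall y : L, K (wt f g.2 y)) (Ng : stable_sums_in g).

Let splitZ (S : {set T}) x y :
  refine S f x = refine S f y -> (x \in Z) = (y \in Z).
Proof. by case=> _ /fZ. Qed.

Let only i s : same_kernel (comp s) (refine [set i] f) -> refls s ->
  forall t, t \in s -> keeps (fun x => x == i) t.
Proof.
move=> S rs t ts x; have /(same_kernelP _ _ S) := comp_keeps rs ts x.
by case; rewrite !inE.
Qed.

Let Kwt i g1 : (forall y : L, wt f g1.2 y = wt f g.2 y) ->
  (\sum_(x in [set i]) g1.2 x)%R = 0%R ->
  forall y : bool * L, K (wt (refine [set i] f) g1.2 y).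
Proof.
move=> E S0 y; rewrite (wt_refine (i := i)) //; last by move=> x /set1P->.
by case: ifP; rewrite // E.
Qed.

Lemma step_cut i : g.1^-1 i != i -> exists s d, good s d f g.
Proof.
move=> ji; set j := g.1^-1 i in ji; have ij : i != j by rewrite eq_sym.
have gj : g.1 j = i by rewrite permKV.
have fij : f i = f j by rewrite -gj fg.
have iZ : (i \in Z) = (j \in Z) by apply: fZ.
pose c := (- g.2 j)%R; pose g1 := swap i j c * g.
have g11 z : g1.1 z = g.1 (tperm i j z) by rewrite wrM1 permM.
have iS : i \in [set i] by rewrite inE.
have jS : j \notin [set i] by rewrite inE.
have Sf x : x \in [set i] -> f x = f i by move/set1P->.
have g1i : g1.1 i = i by rewrite g11 tpermL.
have g12i : g1.2 i = 0%R by rewrite wrM2 /= !ffunE eqxx tpermL addNr.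
have ksw : keeps f (swap i j c) by apply/keeps_swap.
have wE (y : L) : wt f g1.2 y = wt f g.2 y by rewrite wtM // wt_swap // add0r.
have S0 : (\sum_(x in [set i]) g1.2 x)%R = 0%R by rewrite big_set1.
have nnonzeroE : nnonzero (refine [set i] f) g1.2 = nnonzero f g.2.
  by rewrite (nnonzero_refine Sf) //; apply: eq_nnonzero.
have labE := nlabels_refine iS jS fij Sf.
have := nlabels_le (refine [set i] f); rewrite labE => lab_lt.
have [|||||s [d [rs gE S1 ts ds]]] := IH (f := refine [set i] f) (g := g1).
- by rewrite labE nnonzeroE; move: mu lab_lt; lia.
- move=> z; rewrite /refine !inE; congr pair.
    by rewrite -{1}g1i (inj_eq perm_inj).
  by rewrite g11 fg; case: tpermP => // ->.
- exact: splitZ.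
- exact: Kwt.
- move=> S Sg1 SZ; pose S' := [set z | if z == i then j \in S else z \in S].
  have kS : keeps (fun z => z \in S') (swap i j c).
    by apply/keeps_swap; rewrite !inE eqxx (negPf ji).
  have -> : (\sum_(x in S) g1.2 x = \sum_(x in S') g1.2 x)%R.
    rewrite big_mkcond [RHS]big_mkcond; apply: eq_bigr => z _; rewrite inE.
    by case: eqP => // ->; rewrite g12i !if_same.
  have -> : (\sum_(x in S') g1.2 x = \sum_(x in S') g.2 x)%R.
    have := wtM g true kS; rewrite wt_swap // ?add0r; last first.
      by rewrite !inE eqxx (negPf ji).
    by rewrite /wt; under eq_bigl do rewrite eqb_id;
      under [X in _ = X]eq_bigl do rewrite eqb_id.
  apply: Ng => [z|]; last first.
    apply/subsetP=> z; rewrite inE; case: eqP => [->|_];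
      last exact: (subsetP SZ).
    by rewrite iZ; apply: (subsetP SZ).
  rewrite !inE; have [zj|zj] := eqVneq z j.
    by rewrite zj gj eqxx (negPf ji).
  have gz : g.1 z != i by rewrite -gj (inj_eq perm_inj).
  rewrite (negPf gz); have [zi|zi] := eqVneq z i.
    by rewrite zi -[in RHS]Sg1 g11 tpermR.
  by rewrite -[in RHS]Sg1 g11 tpermD // eq_sym.
exists (swap i j c :: s), (fun x => if x == i then c + d j else d x)%R; split.
- by apply/refls_cons; split=> //; apply: ReflSwap.
- by rewrite prods_cons gE /g1 mulgA swap_sq // mul1g.
- exact: same_kernel_trans (comp_swap c s ij) (merge_refine iS jS fij Sf S1).
- have S2 := same_kernel_trans (comp_swap c s ij) (merge_refine iS jS fij Sf
    S1).
  move: ts; rewrite /tight prods_cons gE /g1 mulgA swap_sq // mul1g.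
  rewrite (nlabels_same_kernel S2) (nnonzero_same_kernel _ S2)
    (nlabels_same_kernel S1) (nnonzero_same_kernel _ S1).
  have orb : i \in porbit g.1 j by rewrite -gj (mem_porbit g.1 1).
  rewrite labE nnonzeroE; have := ncycles_swap c g ij;
    rewrite orb addn0 => -> /=.
  by move: (nnonzero _ _) (nlabels _) (ncycles _) #|T| (size s); lia.
- move=> t; rewrite inE => /orP[/eqP->|ts'].
    by apply: compatible_swap => // _;
      rewrite eqxx (negPf ji) opprD addrA subrr add0r addNr.
  by apply: compatible_change1; [apply: (only S1)|apply: ds].
Qed.

Lemma step_pair i j : g.1 = 1 -> i != j -> f i = f j ->
  exists s d, good s d f g.
Proof.
move=> g1 ij fij; have iZ := fZ fij.
have iS : i \in [set i] by rewrite inE.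
have jS : j \notin [set i] by rewrite inE eq_sym.
have Sf x : x \in [set i] -> f x = f i by move/set1P->.
have Sg x : (g.1 x \in [set i]) = (x \in [set i]) by rewrite g1 perm1.
have labE := nlabels_refine iS jS fij Sf.
have := nlabels_le (refine [set i] f); rewrite labE => lab_lt.
pose g2 := unpair g [set i] i j.
have S0 : (\sum_(x in [set i]) g2.2 x)%R = 0%R := unpair_sum g iS jS.
have wE : wt f g2.2 =1 wt f g.2 := unpair_wt g iS jS fij.
have Ni := (stable_sums_in1 g1).1 Ng.
have [|||||s [d [rs gE S1 ts ds]]] := IH (f := refine [set i] f) (g := g2).
- by rewrite labE (nnonzero_refine Sf) // (eq_nnonzero wE); move: mu lab_lt;
    lia.
- exact: unpair_keeps.
- exact: splitZ.
- by apply: Kwt => // y; apply: wE.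
- apply/stable_sums_in1 => [|x xZ]; first by rewrite unpair1.
  rewrite unpair2 // big_set1 opprK; case: eqP => [->|_].
    by rewrite subrr.
  case: eqP => [xj|_]; last by rewrite addr0 Ni.
  by rewrite -[g.2 i]opprK; apply: NB; rewrite ?NN ?Ni // iZ -xj.
have [rs' gE' S2 ts'] := pair_tight iS jS fij Sf rs gE S1 ts.
exists [:: swap i j 0, swap i j (- \sum_(x in [set i]) g.2 x)%R & s].
exists (fun x => if x == i then d j else d x)%R; split=> // t.
rewrite !inE eq_sym in jS; rewrite !inE => /or3P[/eqP->|/eqP->|tin].
- by apply: compatible_swap => // _; rewrite eqxx eq_sym (negPf ij) sub0r addNr.
- apply: compatible_swap => // iZ'.
  by rewrite eqxx eq_sym (negPf ij) addrNK big_set1 NN ?Ni.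
- by apply: compatible_change1; [apply: (only S1)|apply: ds].
Qed.

Lemma step_diag i : g.1 = 1 -> injective f -> g.2 i != 0%R ->
  exists s d, good s d f g.
Proof.
move=> g1 fI gi; pose k := g.2 i; pose g' := diag1 i (- k)%R * g.
have wtx x (a : W) : wt f a.2 (f x) = a.2 x.
  by rewrite /wt (big_pred1 x) // => y; rewrite (inj_eq fI).
have kd b : keeps f (diag1 i b) by apply: keeps_diag1.
have wE (y : L) : wt f g'.2 y = ((if y == f i then - k else 0) + wt f g.2 y)%R.
  by rewrite wtM ?wt_diag1.
have g'i : wt f g'.2 (f i) = 0%R by rewrite wE eqxx wtx addNr.
have wN (y : L) : y != f i -> wt f g'.2 y = wt f g.2 y.
  by move/negPf=> yi; rewrite wE yi add0r.
have nnonzeroE : nnonzero f g.2 = (nnonzero f g'.2).+1.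
  rewrite /nnonzero (cardsD1 (f i)) inE wtx gi; congr _.+1; apply: eq_card => y.
  rewrite !inE; have [->|yi] := eqVneq y (f i); first by rewrite g'i eqxx.
  by rewrite wN.
have Ni := (stable_sums_in1 g1).1 Ng.
have g'1 : g'.1 = 1 by rewrite wrM1 g1 mulg1.
have [|||||s [d [rs gE S1 ts ds]]] := IH (f := f) (g := g') => //.
- by move: mu; rewrite nnonzeroE; lia.
- by move=> x; rewrite g'1 perm1.
- by move=> y; have [->|/wN->] := eqVneq y (f i); rewrite // g'i.
- apply/stable_sums_in1 => // x xZ; rewrite wrM2 perm1 /= ffunE.
  by case: eqP => [->|_]; rewrite ?addNr ?add0r ?Ni.
have gE2 : prods (diag1 i k :: s) = g.
  rewrite prods_cons gE /g' mulgA [diag1 i k * _](_ : _ = 1) ?mul1g //.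
  apply: wr_eq => [|x]; first by rewrite wrM1 mulg1.
  by rewrite wrM2 /= perm1 !ffunE; case: ifP; rewrite ?subrr ?addr0.
exists (diag1 i k :: s), d; split=> //.
- by apply/refls_cons; split=> //; apply: ReflDiag1; rewrite // /k -wtx.
- by rewrite comp_diag1.
- move: ts; rewrite /tight gE2 comp_diag1 gE (nnonzero_same_kernel _ S1)
    (nnonzero_same_kernel _ S1) nnonzeroE.
  by rewrite /ncycles g1 g'1 /= addSn addnS => ->.
- move=> t; rewrite inE => /orP[/eqP->|]; last exact: ds.
  move=> x xZ /=; rewrite perm1 addrNK ffunE.
  by case: eqP => // xi; rewrite /k -xi Ni.
Qed.

End Steps.

(** As long as the permutation moves some point i, an edge of suitable weight
    makes i a fixed point of weight zero.  Once the permutation is trivial,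
    points with a common label are separated by pairs of parallel edges, and
    diagonal reflections do the rest. *)
Theorem tight_exists (L : finType) (f : T -> L) g : keeps f g ->
  (forall x y, f x = f y -> (x \in Z) = (y \in Z)) ->
  (forall y : L, K (wt f g.2 y)) -> stable_sums_in g ->
    exists s d, good s d f g.
Proof.
move: {2}(_ + _).+1 (ltnSn ((#|T| - nlabels f) + nnonzero f g.2)) => n.
elim: n L f g => // n IHn L f g mu fg fZ Kf Ng.
have [/existsP[i ii]|/existsPn fix_] := boolP [exists i, g.1^-1 i != i].
  exact: (step_cut IHn mu fg fZ Kf Ng ii).
have g1 : g.1 = 1.
  apply/permP=> x; rewrite perm1 -{1}(eqP (negbNE (fix_ x))).
  exact: permKV.
have [/existsP[i /existsP[j /andP[ij /eqP fij]]]|nf] :=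
  boolP [exists i, exists j, (i != j) && (f i == f j)].
  exact: (step_pair IHn mu fg fZ Kf Ng g1 ij fij).
have fI : injective f.
  move=> x y E; apply/eqP/negPn/negP => xy; case/negP: nf.
  by apply/existsP; exists x; apply/existsP; exists y; rewrite xy E eqxx.
have [/existsP[i gi]|/existsPn g0] := boolP [exists i, g.2 i != 0%R].
  exact: (step_diag IHn mu fZ Kf Ng g1 fI gi).
have gE : g = 1.
  by apply: wr_eq => // x; rewrite wr12E; apply/eqP/negPn.
have P : prods [::] = g by rewrite /prods big_nil gE.
exists [::], (fun=> 0%R); split=> //; first by move=> x y;
  rewrite /= (inj_eq fI).
rewrite /tight P cyc1 // /nlabels imset_id cardsT /nnonzero eq_card0 ?addn0
  ?addnn //.
by move=> y; rewrite inE /wt big1 ?eqxx // => x _; apply/eqP/negPn.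
Qed.

End Exist.

(** * Stabilizers of Hurwitz orbits *)

Section Stab.
Variables (T : finType) (A : zmodType) (K : A -> bool).
Local Notation W := (wreath T A).
Local Notation refls := (@refls T A K).
Implicit Types (i j x y : T) (k c a b : A) (g t w : W) (s p q : seq W).
Implicit Types (h : {ffun T -> A}) (S : {set T}).
Hypotheses (K0 : K 0%R) (KD : forall a b, K a -> K b -> K (a + b)%R).

(** The weight of a component is the sum of its diagonal entries. *)
Lemma K_comp s (y : T) : refls s -> K (wt (comp s) (prods s).2 y).
Proof.
move=> rs; have kf := comp_keeps rs; move: (comp s) kf => f kf.
elim: s rs kf => [_ _|t s IHs /refls_cons[rt rs] kf].
  by rewrite /prods big_nil /wt big1 // => x _; rewrite ffunE.
have ks z : z \in s -> keeps f z by move=> zs; apply: kf; rewrite inE zs orbT.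
have kt := kf _ (mem_head _ _); rewrite prods_cons wtM //.
apply: KD; last exact: IHs.
case: rt kt => [i j c ij /keeps_swap E|i k _ Kk _]; first by rewrite wt_swap.
by rewrite wt_diag1; case: ifP.
Qed.

Definition indic S a : {ffun T -> A} := [ffun x => if x \in S then a else 0%R].

Definition Stab s h : Prop := hurwitz (conj_diag h s) s.

Lemma Stab0 s : Stab s 0%R.
Proof. by rewrite /Stab conj_diag0; apply: hurwitz_refl. Qed.

Lemma StabD s h h' : Stab s h -> Stab s h' -> Stab s (h + h')%R.
Proof.
move=> H H'; rewrite /Stab conj_diagD; apply: hurwitz_trans H';
  exact: hurwitz_conj.
Qed.

Lemma StabN s h : Stab s h -> Stab s (- h)%R.
Proof.
move=> H; have := hurwitz_conj (diag (- h)%R) H;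
  rewrite -/(conj_diag _ _) -conj_diagD subrr.
by rewrite conj_diag0; apply: hurwitz_sym.
Qed.

Lemma StabB s h h' : Stab s h -> Stab s h' -> Stab s (h - h')%R.
Proof. by move=> H H'; apply: StabD => //; apply: StabN. Qed.

Lemma StabMn s h n : Stab s h -> Stab s (h *+ n)%R.
Proof.
by move=> H; elim: n => [|n IHn]; [apply: Stab0 | rewrite mulrS; apply: StabD].
Qed.

Definition stable g S : Prop := forall x, (g.1 x \in S) = (x \in S).

Lemma stable_porbit g i : stable g (porbit g.1 i).
Proof.
by move=> x; have := porbit_perm g.1 1 x; rewrite expg1 -!eq_porbit_mem => ->.
Qed.

(** Conjugating by the total weight of S placed on S stays in the orbit: the
    orbit contains a factorization beginning with two parallel edges that
    connect the tight factorizations of S and of the rest of its component,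
    and a single move of that pair has this effect. *)
Lemma Stab_stable s S i : refls s -> tight s -> stable (prods s) S ->
    (forall x, x \in S -> comp s x = comp s i) ->
  Stab s (indic S (\sum_(x in S) (prods s).2 x)%R).
Proof.
move=> rs ts; set g := prods s => Sg Si; set w := (\sum_(x in S) _)%R.
have [S0|[i0 iS]] := set_0Vmem S.
  rewrite /indic S0 [finfun _](_ : _ = 0%R); first exact: Stab0.
  by apply/ffunP=> x; rewrite !ffunE inE.
have [/existsP[j /andP[/eqP cj jS]]|] :=
  boolP [exists j, (comp s j == comp s i) && (j \notin S)];
  last first.
  move=> /existsPn H; rewrite /Stab (conj_diag_id rs);
    first exact: hurwitz_refl.
  have HS z : (z \in S) = (comp s z == comp s i).
    apply/idP/eqP => [/Si//|cz]; move: (H z); rewrite cz eqxx /=.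
    by rewrite negbK.
  by move=> x y E; rewrite !ffunE !HS E.
have Sf x : x \in S -> comp s x = comp s i0 by move=> /Si->; rewrite Si.
have fij : comp s i0 = comp s j by rewrite cj Si.
have ij : i0 != j by apply: contraNneq jS => <-.
pose g2 := unpair g S i0 j; have ks := comp_prods rs.
have [] := @tight_exists _ _ K K0 xpredT set0 isT (fun _ _ _ _ =>
  isT) _ (refine S (comp s)) g2.
- exact: unpair_keeps.
- by move=> x y _; rewrite !inE.
- move=> y; rewrite (wt_refine Sf) ?unpair_sum //; case: ifP => // _.
  by rewrite unpair_wt //; apply: K_comp.
- by [].
move=> s2 [_ [rs2 g2E S2 ts2 _]].
have [rs3 g3E S3 ts3] := pair_tight iS jS fij Sf rs2 g2E S2 ts2.
set s3 := [:: _, _ & _] in rs3 g3E S3 ts3.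
have rot : Stab s3 (indic S w).
  have chS : conj_diag (indic S w) s2 = s2.
    apply: (conj_diag_id rs2) => x y /(same_kernelP _ _ S2)[E _].
    by rewrite !ffunE E.
  apply: hurwitz_sym; have :=
    hurwitz_step [::] s2 (swap i0 j 0) (swap i0 j (- w)%R).
  have -> : swap i0 j 0 ^ swap i0 j (- w)%R = swap i0 j (- w - w)%R.
    rewrite swapJ //= tpermL tpermR swapC 1?eq_sym // !ffunE !eqxx.
    by rewrite [j == i0]eq_sym (negPf ij) sub0r opprD !opprK.
  rewrite /= chS -/w !swap_diag // !ffunE iS (negPf jS) !addr0 sub0r.
  by [].
have [h0 [_ H0]] := tight_conj rs3 rs g3E S3 ts3 ts.
apply: hurwitz_trans (hurwitz_sym H0);
  apply: hurwitz_trans (hurwitz_conj _ H0) _.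
rewrite -[map _ _]/(conj_diag _ (conj_diag h0 s3)) -conj_diagD addrC conj_diagD.
exact: hurwitz_conj.
Qed.

Variables (gen : A) (m : nat).
Hypotheses (genP : forall a, exists n,
  a = (gen *+ n)%R) (gen_m : (gen *+ m = 0)%R).

Lemma indicD S a b : indic S (a + b)%R = (indic S a + indic S b)%R.
Proof. by apply/ffunP=> x; rewrite !ffunE; case: ifP; rewrite ?addr0. Qed.

Lemma indicMn S a n : indic S (a *+ n)%R = (indic S a *+ n)%R.
Proof.
elim: n => [|n IHn]; last by rewrite !mulrS indicD IHn.
by apply/ffunP=> x; rewrite !ffunE if_same.
Qed.

(** The form w(S) 1_S of the previous lemma is quadratic in S; polarizing it
    puts the square of each cycle weight of the component, times the indicator
    of the cycle of i, in the stabilizer.  These squares and m have no common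
    factor when the weights and m have none. *)
Lemma Stab_cycle s i (g := prods s) (wn : T -> nat) :
    refls s -> tight s ->
    (forall j, (gen *+ wn j = \sum_(x in porbit g.1 j) g.2 x)%R) ->
    (forall q : nat, prime q -> q %| m ->
      exists j, comp s j = comp s i /\ ~~ (q %| wn j)) ->
  forall a, Stab s (indic (porbit g.1 i) a).
Proof.
move=> rs ts wnE H; set C := porbit g.1; have ks := comp_prods rs.
have cC x y : x \in C y -> comp s x = comp s y by apply: keeps_porbit.
pose I (n : nat) := Stab s (indic (C i) (gen *+ n)%R).
have IgcdD (k l : nat) : I k -> I l -> I (gcdn k l).
  move=> Ik Il; have [->|k0] := posnP k; first by rewrite gcd0n.
  case: (egcdnP l k0) => u v E _.
  have /(StabB (StabMn u Ik)) := StabMn v Il.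
  rewrite /I -!indicMn -!mulrnA [(k * u)%N]mulnC [(l * v)%N]mulnC E mulrnDr.
  by rewrite indicD addrC addKr.
have one S : stable g S -> (forall x, x \in S -> comp s x = comp s i) ->
    Stab s (indic S (\sum_(x in S) g.2 x)%R) by apply: Stab_stable.
have Cj j : comp s j = comp s i -> Stab s (indic (C j) (gen *+ wn j)%R).
  move=> ji; rewrite wnE; apply: one; first exact: stable_porbit.
  by move=> x /cC->.
have Isq j : comp s j = comp s i -> I (wn j * wn j)%N.
  move=> ji; have [Eij|Nij] := eqVneq (C i) (C j).
    by rewrite /I Eij mulrnA indicMn; apply: StabMn; apply: Cj.
  have dis x : x \in C i -> x \notin C j.
    move=> xi; apply: contra Nij => xj.
    by rewrite -(eqP (_ : C x == C i)) ?eq_porbit_mem.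
  have Sw : (\sum_(x in C i :|: C j) g.2 x = gen *+ wn i + gen *+ wn j)%R.
    rewrite !wnE big_mkcond [X in (X + _)%R]big_mkcond [X in (_ +
      X)%R]big_mkcond.
    rewrite -big_split; apply: eq_bigr => x _; rewrite inE.
    have [/dis/negPf->|_] := boolP (x \in C i); first by rewrite /= addr0.
    by rewrite /= add0r.
  have Sij : Stab s (indic (C i :|: C j) (gen *+ wn i + gen *+ wn j)%R).
    rewrite -Sw; apply: one.
      by move=> x; rewrite !inE !stable_porbit.
    by move=> x; rewrite inE => /orP[/cC->//|/cC->].
  have chU a : indic (C i :|: C j) a = (indic (C i) a + indic (C j) a)%R.
    apply/ffunP=> x; rewrite !ffunE inE.
    have [/dis/negPf->|_] := boolP (x \in C i); first by rewrite /= addr0.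
    by rewrite /= add0r.
  have Smix : Stab s (indic (C i) (gen *+ wn j)%R + indic (C j) (gen *+ wn
    i)%R)%R.
    have := StabB (StabB Sij (Cj i erefl)) (Cj j ji); rewrite chU !indicD.
    by rewrite -addrA -opprD [(indic (C i) _ + _)%R]addrC addrACA addrK.
  have := StabB (StabMn (wn j) Smix) (StabMn (wn i) (Cj j ji)).
  by rewrite mulrnDl -!indicMn -!mulrnA [(wn i * _)%N]mulnC addrK.
have I1 : I 1%N.
  pose G := \big[gcdn/0]_(j | comp s j == comp s i) (wn j * wn j)%N.
  have IG : I (gcdn m G).
    apply: (IgcdD); first by rewrite /I gen_m -(mulr0n gen) indicMn mulr0n;
      apply: Stab0.
    apply: (big_ind I) => [||j /eqP/Isq//]; last exact: IgcdD.
    by rewrite /I indicMn mulr0n; apply: Stab0.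
  suff E : gcdn m G = 1%N by rewrite E in IG.
  apply/eqP/negPn/negP => N1; have [q pq] : exists2 q, prime q & q %| gcdn m G.
    move: N1; case: (gcdn m G) => [|[|n]] // _; first by exists 2.
    by exists (pdiv n.+2); rewrite ?pdiv_prime ?pdiv_dvd.
  rewrite dvdn_gcd => /andP[qm qG].
  have [j [ji /negP[]]] := H q pq qm.
  have := dvdn_trans qG (biggcdn_inf j _ (dvdnn _)).
  by rewrite Euclid_dvdM // orbb; apply; apply/eqP.
by move=> a; have [n ->] := genP a; rewrite indicMn; apply: StabMn.
Qed.

(** The diagonal conjugation that relates s and s' decomposes over the cycles.
    On a cycle that fills its component it is trivial, and on the others it
    stabilizes the orbit by the previous lemma. *)
Theorem tight_transitive s s' (g := prods s) (wn : T -> nat) :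
    refls s -> refls s' -> prods s' = g -> same_kernel (comp s) (comp s') ->
    tight s -> tight s' ->
    (forall j, (gen *+ wn j = \sum_(x in porbit g.1 j) g.2 x)%R) ->
    (forall i, (forall j, comp s j = comp s i -> j \in porbit g.1 i) \/
       forall q : nat, prime q -> q %| m ->
         exists j, comp s j = comp s i /\ ~~ (q %| wn j)) ->
  hurwitz s s'.
Proof.
move=> rs rs' gE S ts ts' wnE H; have ks := comp_prods rs.
have [h [kh Hh]] := tight_conj rs rs' (esym gE) S ts ts'.
apply: hurwitz_trans (hurwitz_sym Hh); apply: hurwitz_sym; rewrite -/(Stab s h).
have -> : h = (\sum_(C in porbits g.1) [ffun x =>
  if x \in C then h x else 0])%R.
  apply/ffunP=> x; rewrite sum_ffunE (bigD1 (porbit g.1 x)) ?imset_f //=.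
  rewrite ffunE porbit_id big1 ?addr0 // => _ /andP[/imsetP[z _ ->] Nz].
  rewrite ffunE; case: ifP => // xz; case/eqP: Nz.
  by apply/eqP; rewrite eq_sym eq_porbit_mem.
apply: (big_ind (Stab s)) => [||_ /imsetP[i _ ->]];
  [exact: Stab0|exact: StabD|].
have -> : [ffun x => if x \in porbit g.1 i then h x else 0%R] = indic (porbit
  g.1 i) (h i).
  by apply/ffunP=> x; rewrite !ffunE; case: ifP => // /(keeps_porbit kh)->.
case: (H i) => [Hi|Hi]; last exact: Stab_cycle.
rewrite /Stab (conj_diag_id rs); first exact: hurwitz_refl.
have Ci x : (x \in porbit g.1 i) = (comp s x == comp s i).
  by apply/idP/eqP => [/(keeps_porbit ks)//|/Hi].
by move=> x y E; rewrite !ffunE !Ci E.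
Qed.

End Stab.

Section Separation.
Variables (T : finType) (A : zmodType) (K : A -> bool).
Local Notation W := (wreath T A).
Local Notation refls := (@refls T A K).
Implicit Types (i j x y : T) (a b c : A) (g t : W) (s : seq W).
Variables (N : A -> bool) (Z : {set T}) (d : T -> A).
Hypotheses (N0 : N 0%R) (NB : forall a b, N a -> N b -> N (a - b)%R).

Let NN a : N a -> N (- a)%R.
Proof. by move=> Na; rewrite -sub0r; apply: NB. Qed.

Let ND a b : N a -> N b -> N (a + b)%R.
Proof. by move=> Na Nb; rewrite -[b]opprK; apply: NB => //; apply: NN. Qed.

Let ok t := keeps (fun x => x \in Z) t /\ compatible N Z d t.

Let okM t t' : ok t -> ok t' -> ok (t * t').
Proof.
move=> [kt ct] [kt' ct']; split; first exact: keepsM.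
move=> x xZ; rewrite wrM2 wrM1 permM.
have := ND (ct x xZ) (ct' (t.1 x) _); rewrite kt => /(_ xZ).
rewrite addrA; set b := t'.2 _; set e := d (t.1 x).
by rewrite (addrC b) (addrA _ (- e)%R) addrK (addrAC _ _ b).
Qed.

Let okV t : ok t -> ok t^-1.
Proof.
move=> [kt ct]; split; first exact: keepsV.
move=> x xZ; rewrite wrV2 wrV1.
have yZ : t.1^-1 x \in Z by rewrite -[_ \in Z](kt) permKV.
have := NN (ct _ yZ); rewrite permKV.
by rewrite opprD opprB -addrA addrC -addrA addrCA addrA.
Qed.

Let okJ t t' : ok t -> ok t' -> ok (t ^ t').
Proof.
by move=> okt okt'; rewrite conjgE; apply: okM; [apply: okV | apply: okM].
Qed.

(** The elements compatible with d form a group, so Hurwitz moves preserve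
    compatibility of all the entries.  If the conjugate of s were compatible
    too, no edge could leave the cycle of i, contradicting the connection
    between i and j. *)
Theorem not_Stab s i j a : refls s ->
    (forall x y, comp s x = comp s y -> (x \in Z) = (y \in Z)) ->
    (forall t, t \in s -> compatible N Z d t) -> ~~ N a ->
    i \in Z -> comp s i = comp s j -> j \notin porbit (prods s).1 i ->
  ~ Stab s (indic (porbit (prods s).1 i) a).
Proof.
move=> rs sZ cs Na iZ cij nij; set C := porbit _ i => H.
have Nn : ~~ N (- a)%R by apply: contra Na => /NN; rewrite opprK.
have kZ t : t \in s -> keeps (fun x => x \in Z) t.
  by move=> tin x; apply: sZ; apply: (comp_keeps rs tin).
have oks : forall t, t \in s -> ok t by move=> t tin; split;
  [exact: kZ|exact: cs].
have okc : forall t, t \in conj_diag (indic C a) s -> ok t.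
  apply/(hurwitz_forall _ _ H) => [t t' okt okt'|t t' okt okt'|//].
    exact: okJ.
  by apply: okJ => //; apply: okV.
have k t : t \in s -> keeps (fun x => (x \in Z) && (x \in C)) t.
  move=> tin; have [_] := okc _ (map_f _ tin); have := cs t tin;
    have := kZ t tin.
  case: (rs t tin) => [x y c xy|x b _ _ _ _ _]; last exact: keeps_diag1.
  rewrite swap_diag // => /keeps_swap xyZ c1 c2; apply/keeps_swap.
  rewrite -xyZ; case: (boolP (x \in Z)) => //= xZ.
  have := NB (c2 x xZ) (c1 x xZ); rewrite /= !ffunE eqxx tpermL.
  rewrite -!(addrA _ (- d x)%R) opprD addrACA subrr addr0 -(addrA c) (addrC c)
    addrK.
  do 2!case: ifP => _ //; first by rewrite addr0 (negPf Nn).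
  by rewrite oppr0 add0r (negPf Na).
have := comp_univ rs k cij; rewrite iZ -(sZ _ _ cij) iZ /=.
by rewrite porbit_id (negPf nij).
Qed.

End Separation.

(** * Cycle partitions *)

Section CyclePartitions.
Variables (T : finType) (m' : nat).
Local Notation m := m'.+1.
Local Notation A := 'I_m.
Local Notation W := (wreath T A).
Implicit Types (x y : T) (c : {set T}) (B : {set {set T}}).
Implicit Types (P Q : {set {set {set T}}}) (g : W).

Definition block_of g P x : {set {set T}} := pblock P (porbit g.1 x).

Definition cycle_weight g c : nat := \sum_(x in c) (g.2 x : nat).
Definition block_weight g B : nat := \sum_(c in B) cycle_weight g c.

Lemma inZp_sum (I : Type) (r : seq I) (C : pred I) (F : I -> nat) :
  inZp (\sum_(i <- r | C i) F i) = (\sum_(i <- r | C i) (inZp (F i) : A))%R.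
Proof.
apply: (big_morph (inZp : nat -> A)) => [a b|]; last exact: val_inj.
by apply: val_inj; rewrite /= modnDm.
Qed.

Lemma cycle_weightE g c : inZp (cycle_weight g c) = (\sum_(x in c) g.2 x)%R.
Proof. by rewrite inZp_sum; apply: eq_bigr => x _; rewrite valZpK. Qed.

Lemma inZp_eq0 k : (inZp k == 0%R :> A) = (m %| k).
Proof. by rewrite -val_eqE. Qed.

Lemma dvdn_inZp r k : r %| m -> (r %| (inZp k : A)) = (r %| k).
Proof. by move=> rm; rewrite /dvdn /= modn_dvdm. Qed.

Section Labels.
Variables (g : W) (P : {set {set {set T}}}).
Hypothesis partP : partition P (porbits g.1).

Let tiP : trivIset P. Proof. by case/and3P: partP. Qed.
Let covP : cover P = porbits g.1. Proof. by case/and3P: partP => /eqP. Qed.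

Lemma orb_cover x : porbit g.1 x \in cover P.
Proof. by rewrite covP imset_f. Qed.

Lemma block_of_keeps : keeps (block_of g P) g.
Proof. by move=> x; have := porbit_perm g.1 1 x;
  rewrite expg1 /block_of => ->. Qed.

Lemma block_of_in x : block_of g P x \in P.
Proof. by rewrite pblock_mem ?orb_cover. Qed.

Lemma in_cycle c B : B \in P -> c \in B -> exists x, c = porbit g.1 x.
Proof.
move=> BP cB; have : c \in cover P by apply/bigcupP; exists B.
by rewrite covP => /imsetP[x _ ->]; exists x.
Qed.

Lemma block_of_eq x B : B \in P -> (block_of g P x == B) = (porbit g.1 x \in B).
Proof.
move=> BP; apply/eqP/idP => [<-|]; first by rewrite mem_pblock orb_cover.
exact: def_pblock.
Qed.

Lemma block_of_image : block_of g P @: [set: T] = P.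
Proof.
apply/setP=> B; apply/imsetP/idP => [[x _ ->]|BP]; first exact: block_of_in.
have [B0|[c cB]] := set_0Vmem B.
  by case/and3P: partP => _ _; rewrite -B0 BP.
have [x E] := in_cycle BP cB; exists x => //.
by apply/esym/eqP; rewrite block_of_eq // -E.
Qed.

Lemma block_of_wt B : B \in P ->
  wt (block_of g P) g.2 B = inZp (block_weight g B).
Proof.
move=> BP; rewrite inZp_sum /wt (partition_big (porbit g.1) (mem B)) /=;
  last first.
  by move=> x; rewrite block_of_eq.
apply: eq_bigr => c cB; rewrite cycle_weightE; apply: eq_bigl => x.
have [z E] := in_cycle BP cB; rewrite E eq_porbit_mem andb_idl //.
by rewrite -eq_porbit_mem block_of_eq // => /eqP->; rewrite -E.
Qed.

Definition partition_value g P : nat :=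
  #|P| + #|[set B in P | m %| block_weight g B]|.

(** The value counts the blocks of weight zero twice and the others once. *)
Lemma partition_value_nlabels : partition_value g P + nnonzero (block_of g P)
  g.2 = (nlabels (block_of g P)).*2.
Proof.
rewrite /partition_value /nlabels block_of_image -addnn -addnA; congr (_ + _)%N.
have -> : nnonzero (block_of g P) g.2 = #|P :\: [set B in P | m %|
  block_weight g B]|.
  apply: eq_card => B; rewrite !inE; have [BP|BP] := boolP (B \in P).
    by rewrite block_of_wt // inZp_eq0 andbT.
  by rewrite wt_empty ?eqxx ?andbF // block_of_image.
rewrite -(cardsID [set B in P | m %| block_weight g B] P); congr (_ + _)%N.
by apply: eq_card => B; rewrite !inE andbA andbb.
Qed.

End Labels.

Lemma block_of_inj g P Q : partition P (porbits g.1) ->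
  partition Q (porbits g.1) ->
  same_kernel (block_of g P) (block_of g Q) -> P = Q.
Proof.
move=> pP pQ S; rewrite -(preim_partition_pblock pP) -(preim_partition_pblock
  pQ).
apply: eq_in_imset => _ /imsetP[x _ ->]; apply/setP=> c; rewrite !inE.
by apply: andb_id2l => /imsetP[y _ ->]; apply: S.
Qed.

Lemma block_of_exists (L : finType) (f : T -> L) g : keeps f g ->
  exists2 P, partition P (porbits g.1) & same_kernel (block_of g P) f.
Proof.
move=> fg; pose F c := f @: c; exists (preim_partition F (porbits g.1)).
  exact: preim_partitionP.
have FE x : F (porbit g.1 x) = [set f x].
  apply/setP=> y; rewrite inE; apply/imsetP/eqP => [[z zx ->]|->].
    exact: keeps_porbit zx.
  by exists x; rewrite ?porbit_id.
have pF := preim_partitionP F (porbits g.1).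
have /and3P[/eqP cF tF _] := pF.
move=> x y; rewrite /block_of eq_pblock // ?cF ?imset_f //.
rewrite pblock_equivalence_partition ?imset_f //.
  by rewrite !FE (inj_eq set1_inj).
by split=> // /eqP->.
Qed.

Section Main.
Variables (p : nat) (pm : p %| m) (g : W).
Let K (a : A) := p %| a.
Local Notation refls := (@refls T A K).

Definition is_factorization (s : seq W) : Prop := refls s /\ prods s = g.
Definition is_shortest (s : seq W) : Prop :=
  is_factorization s /\ forall s', is_factorization s' -> size s <= size s'.

Definition is_cycle_partition P : bool :=
  partition P (porbits g.1) && [forall B in P, p %| block_weight g B].
Definition best_partitions : {set {set {set {set T}}}} :=
  [set P | is_cycle_partition P & [forall Q,
    is_cycle_partition Q ==> (partition_value g Q <= partition_value g P)]].

Let K0 : K 0%R. Proof. exact: dvdn0. Qed.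

Let KD a b : K a -> K b -> K (a + b)%R.
Proof. by move=> Ka Kb; rewrite [K _]dvdn_inZp // dvdn_add. Qed.

Let one : A := inZp 1.

Let oneM k : (one *+ k)%R = inZp k.
Proof. by apply: val_inj; rewrite Zp_mulrn /= modnMml mul1n. Qed.

Lemma tight_of_partition (N : A -> bool) (Z : {set T}) P :
    N 0%R -> (forall a b, N a -> N b -> N (a - b)%R) -> stable_sums_in N Z g ->
    (forall x y, block_of g P x = block_of g P y ->
      (x \in Z) = (y \in Z)) -> is_cycle_partition P ->
  exists s d, [/\ is_factorization s, same_kernel (comp s) (block_of g P),
    tight s, size s + partition_value g P = #|T| + ncycles g &
    forall t, t \in s -> compatible N Z d t].
Proof.
move=> N0 NB Ng PZ /andP[pP /forallP KP].
have [||||s [d [rs gE S ts cs]]] :=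
  @tight_exists T A K K0 N Z N0 NB _ (block_of g P) g.
- exact: block_of_keeps.
- exact: PZ.
- move=> B; have [BP|BP] := boolP (B \in P).
    by rewrite block_of_wt // /K dvdn_inZp //; apply: (implyP (KP B)).
  by rewrite wt_empty ?K0 // block_of_image.
- by [].
exists s, d; split=> //; have := partition_value_nlabels pP; move: ts.
rewrite /tight gE (nlabels_same_kernel S) (nnonzero_same_kernel _ S) => ts E.
by apply/eqP; rewrite -(eqn_add2r (nnonzero (block_of g P) g.2)) -ts -addnA E.
Qed.

Lemma tight_of_partition_any P : is_cycle_partition P ->
  exists s, [/\ is_factorization s, same_kernel (comp s) (block_of g P),
    tight s & size s + partition_value g P = #|T| + ncycles g].
Proof.
move=> cP; have [||||s [_ [? ? ? ? _]]] :=
  @tight_of_partition xpredT set0 P isT => //.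
  by move=> x y _; rewrite !inE.
by exists s.
Qed.

(** The component labels of a factorization are constant on the cycles, hence
    come from a partition of the cycles; the weight of a component is a sum of
    diagonal entries, hence divisible by p. *)
Lemma partition_of_factorization s : is_factorization s ->
  exists P, [/\ is_cycle_partition P, same_kernel (comp s) (block_of g P),
    #|T| + ncycles g <= size s + partition_value g P &
    size s + partition_value g P = #|T| + ncycles g -> tight s].
Proof.
case=> rs gE; have ks := comp_prods rs; rewrite gE in ks.
have [P pP S] := block_of_exists ks; exists P.
have SS := same_kernel_sym S; have E := partition_value_nlabels pP.
split=> //.
- rewrite /is_cycle_partition pP; apply/forall_inP => B BP.
  move: (BP); rewrite -(block_of_image pP) => /imsetP[x _ Bx].
  rewrite -(dvdn_inZp _ pm) -(block_of_wt pP BP) Bx (wt_same_kernel _ _ S) -gE.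
  exact: (K_comp K0 KD _ rs).
- rewrite -(leq_add2r (nnonzero (block_of g P) g.2)) -[X in _ <= X]addnA E.
  by rewrite -(nlabels_same_kernel SS) -(nnonzero_same_kernel _ SS) -gE;
    apply: (refls_bound rs).
- move=> sE; rewrite /tight gE (nlabels_same_kernel SS) (nnonzero_same_kernel
    _ SS) -sE -addnA.
  by rewrite -E.
Qed.

Lemma hurwitz_is_shortest s s' : is_shortest s -> hurwitz s s' ->
  is_shortest s'.
Proof.
case=> [[rs gE] Hs] H; split; first by split;
  [apply/(hurwitz_refls K H)|rewrite -(hurwitz_prods H)].
by rewrite -(hurwitz_size H).
Qed.

Lemma is_shortest_conj s (h : {ffun T -> A}) : keeps h g ->
  is_shortest s -> is_shortest (conj_diag h s).
Proof.
move=> kh [[rs gE] Hs]; split; last by rewrite size_map.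
by split; [apply: refls_conj | rewrite prods_conj gE keeps_diag].
Qed.

(** Every optimal partition is the component partition of a shortest
    factorization, and equivalent factorizations have the same components.
    For a block B with several cycles whose weights share the factor r with m,
    a shortest factorization with a potential modulo r on B is not equivalent
    to its conjugate by the indicator of one of the cycles. *)
Lemma transitive_best_partition s : is_shortest s ->
  (forall s', is_shortest s' -> hurwitz s s') ->
  exists P, best_partitions = [set P] /\ forall B, B \in P ->
    #|B| = 1%N \/ gcdn m (\big[gcdn/0]_(c in B) cycle_weight g c) = 1%N.
Proof.
move=> [fs Hs] one_orbit;
  have [P [cP S le_s _]] := partition_of_factorization fs.
have maxP Q : is_cycle_partition Q ->
  partition_value g Q <= partition_value g P.
  move=> cQ; have [sQ [fQ _ _ EQ]] := tight_of_partition_any cQ.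
  have := Hs sQ fQ; move: le_s; rewrite -EQ;
    move: (partition_value g P) (partition_value g Q) => a b.
  by move: (size s) (size sQ); lia.
have shortQ Q sQ : is_factorization sQ ->
  size sQ + partition_value g Q = #|T| + ncycles g ->
    partition_value g Q = partition_value g P -> is_shortest sQ.
  move=> fQ EQ VQ; split=> // s' fs'; apply: leq_trans (Hs s' fs').
  by rewrite -(leq_add2r (partition_value g P)) -{1}VQ EQ.
have [pP _] := andP cP.
exists P; split.
  apply/setP=> Q; rewrite !inE; apply/andP/eqP => [[cQ /forallP maxQ]|->];
    last first.
    by split=> //; apply/forall_inP.
  have [sQ [fQ SQ _ EQ]] := tight_of_partition_any cQ.
  have VQ : partition_value g Q = partition_value g P.
    by apply/eqP; rewrite eqn_leq maxP //=; apply: (implyP (maxQ P)).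
  have H := one_orbit _ (shortQ _ _ fQ EQ VQ).
  apply: (block_of_inj (g := g)); [by case/andP: cQ | by [] |].
  exact: same_kernel_trans (same_kernel_sym SQ) (same_kernel_trans
    (same_kernel_sym (hurwitz_comp fs.1 H)) S).
move=> B BP; have [|B1] := eqVneq #|B| 1%N; first by left.
right; set r := gcdn m _; apply/eqP/negPn/negP => r1.
have rm : r %| m by apply: dvdn_gcdl.
have rB c : c \in B -> r %| cycle_weight g c.
  move=> cB; apply: dvdn_trans (dvdn_gcdr _ _) _.
  exact: (biggcdn_inf c cB (dvdnn _)).
pose N (a : A) := r %| a; pose Z := [set x | block_of g P x == B].
have N0 : N 0%R by apply: dvdn0.
have NB a b : N a -> N b -> N (a - b)%R.
  move=> Na Nb; rewrite [N _]dvdn_inZp //; apply: dvdn_add => //=.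
  by rewrite dvdn_inZp // dvdn_sub.
have Ng : stable_sums_in N Z g.
  move=> X gX XZ; rewrite /N.
  have -> : (\sum_(x in X) g.2 x = inZp (\sum_(x in X) (g.2 x : nat)))%R.
    by rewrite inZp_sum; apply: eq_bigr => x _; rewrite valZpK.
  rewrite dvdn_inZp // (partition_big (porbit g.1) (mem B)) /=; last first.
    by move=> x /(subsetP XZ); rewrite inE block_of_eq.
  apply: dvdn_sum => c cB; have [z E] := in_cycle pP BP cB.
  have kX : keeps (fun x => x \in X) g by [].
  have [zX|zX] := boolP (z \in X); last first.
    rewrite big_pred0 ?dvdn0 // => x; apply/negP=> /andP[xX].
    rewrite E eq_porbit_mem => /(keeps_porbit kX) /= Exz.
    by rewrite -Exz xX in zX.
  rewrite (eq_bigl (fun x => x \in c)); first exact: rB.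
  move=> x; rewrite E eq_porbit_mem andb_idl // => /(keeps_porbit kX) /= ->.
  exact: zX.
have [|s1 [d [f1 S1 _ E1 c1]]] := tight_of_partition N0 NB Ng _ cP.
  by move=> x y E; rewrite !inE E.
have short1 := shortQ _ _ f1 E1 erefl; have [r1s g1E] := f1.
have [c cB] : exists c, c \in B.
  by apply/set0Pn; apply: contraTneq BP => ->; case/and3P: pP.
have [c' c'B c'c] : exists2 c', c' \in B & c' != c.
  apply/exists_inP; apply: contraR B1 => /exists_inPn H.
  apply/cards1P; exists c; apply/setP=> z; rewrite inE.
  by apply/idP/eqP => [/H/negPn/eqP|->].
have [i ci] := in_cycle pP BP cB; have [j cj] := in_cycle pP BP c'B.
pose h := indic (porbit g.1 i) one.
have kh : keeps h g by move=> x; rewrite !ffunE stable_porbit.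
have H : hurwitz (conj_diag h s1) s1.
  apply: hurwitz_trans (hurwitz_sym (one_orbit _ (is_shortest_conj kh
    short1))) _.
  exact: one_orbit.
have blockB x c0 : c0 \in B -> c0 = porbit g.1 x -> block_of g P x = B.
  by move=> c0B E; apply/eqP; rewrite block_of_eq // -E.
have [] := @not_Stab T A K N Z d N0 NB s1 i j one r1s.
- by move=> x y /(same_kernelP _ _ S1) E; rewrite !inE E.
- exact: c1.
- by rewrite /N /one dvdn_inZp // dvdn1.
- by rewrite inE (blockB _ _ cB ci).
- by apply/(same_kernelP _ _ S1);
    rewrite (blockB _ _ cB ci) (blockB _ _ c'B cj).
- by rewrite g1E -eq_porbit_mem -cj -ci.
- by rewrite g1E.
Qed.

(** Every shortest factorization is tight and its components form an optimal
    partition, hence P. *)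
Lemma best_partition_transitive P : best_partitions = [set P] ->
    (forall B, B \in P -> #|B| = 1%N \/
       gcdn m (\big[gcdn/0]_(c in B) cycle_weight g c) = 1%N) ->
  exists s, is_shortest s /\ forall s', is_shortest s' -> hurwitz s s'.
Proof.
move=> maxP HB; have : P \in best_partitions by rewrite maxP inE.
rewrite inE => /andP[cP /forallP Pmax]; have [pP _] := andP cP.
have [s [fs S ts sE]] := tight_of_partition_any cP.
have lo s' : is_factorization s' -> size s <= size s'.
  move=> /partition_of_factorization[P' [cP' _ le' _]].
  have := implyP (Pmax P') cP'; move: le'; rewrite -sE; lia.
exists s; split=> // s' [fs' Hs'].
have szE : size s' = size s by apply/eqP; rewrite eqn_leq Hs' //= lo.
have [P' [cP' S' le' ts']] := partition_of_factorization fs'.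
have VP : partition_value g P' = partition_value g P.
  apply/eqP; rewrite eqn_leq (implyP (Pmax P') cP') /=.
  by rewrite -(leq_add2l (size s)) sE -szE.
have PP : P' = P.
  apply/set1P; rewrite -maxP inE cP'; apply/forallP=> Q; rewrite VP.
  exact: Pmax.
have [rs gE] := fs; have [rs' gE'] := fs'.
apply: (@tight_transitive T A K K0 KD one m _ _ s s' (fun j =>
  cycle_weight g (porbit g.1 j))) => //.
- by move=> a; exists a; rewrite oneM valZpK.
- by rewrite oneM; apply/eqP; rewrite inZp_eq0.
- by rewrite gE.
- by rewrite PP in S'; apply: same_kernel_trans S (same_kernel_sym S').
- by apply: ts'; rewrite szE VP.
- by move=> j; rewrite gE oneM cycle_weightE.
move=> i; rewrite gE; set B := block_of g P i.
have BP : B \in P by apply: block_of_in.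
have inB j : comp s j = comp s i <-> porbit g.1 j \in B.
  by rewrite -(block_of_eq pP) //;
    split=> [/(same_kernelP _ _ S)->|/eqP/(same_kernelP _ _ S)].
have iB : porbit g.1 i \in B by apply/inB.
case: (HB B BP) => [/eqP/cards1P[c Bc]|r1]; [left|right].
  move=> j /inB; rewrite Bc inE => /eqP jc; move: iB; rewrite Bc inE => /eqP ic.
  by rewrite -eq_porbit_mem jc ic.
move=> q pq qm; case: (boolP [exists c in B, ~~ (q %| cycle_weight g c)]).
  case/exists_inP=> c cB nq; have [j E] := in_cycle pP BP cB.
  by exists j; split; [apply/inB; rewrite -E | rewrite -E].
move/exists_inPn=> H; suff : q %| 1%N by rewrite Euclid_dvd1.
rewrite -r1 dvdn_gcd qm; apply/dvdn_biggcdP => c cB.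
exact/negPn/H.
Qed.

End Main.
End CyclePartitions.

(** * Monomial matrices *)


Section RootOfUnity.
Variables (R : realType) (m : nat).
Local Open Scope ring_scope.

Lemma omegaX k : omega R m ^+ k =
  (cos (2 * pi / m%:R *+ k) +i* sin (2 * pi / m%:R *+ k))%C.
Proof.
elim: k => [|k IHk]; first by rewrite expr0 mulr0n cos0 sin0.
rewrite exprSr IHk /omega [_ *+ k.+1]mulrSr cosD sinD; simpc.
by rewrite [X in (_ +i* X)%C]addrC.
Qed.

Lemma omega_prim : (0 < m)%N -> m.-primitive_root (omega R m).
Proof.
move=> m0; rewrite /primitive_root_of_unity m0; apply/forallP=> i.
apply/eqP; have mR : m%:R != 0 :> R by rewrite pnatr_eq0 -lt0n.
apply/unity_rootP/eqP => [|->]; rewrite omegaX; last first.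
  rewrite -[_ *+ m]mulr_natr divfK // mulr_natl cos2pi sin2pi.
  by [].
case=> c1 _; apply/eqP; rewrite eqn_leq ltn_ord /= leqNgt; apply/negP => im.
(* half of the angle lies strictly between 0 and pi *)
set x : R := pi / m%:R *+ i.+1.
have x2 : 2 * pi / m%:R *+ i.+1 = x *+ 2.
  by rewrite /x -mulrA mulr_natl mulrnAC.
have : 0 < sin x.
  apply: sin_gt0_pi; rewrite /x -mulr_natr mulr_gt0 ?divr_gt0 ?pi_gt0 ?ltr0n
    //=.
  rewrite -mulrA gtr_pMr ?pi_gt0 // mulrC ltr_pdivrMr ?ltr0n //.
  by rewrite mul1r ltr_nat.
rewrite lt0r -sqrf_eq0 sin2cos2 => /andP[/eqP[]].
have two : 2 != 0 :> R by rewrite pnatr_eq0.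
move: c1; rewrite x2 cos_mulr2n => /eqP; rewrite subr_eq -(mulr_natr (_ ^+ 2)).
by rewrite -[1 + 1]mul1r => /eqP/(mulIf two)->; rewrite subrr.
Qed.

End RootOfUnity.


Section Matrices.
Variables (R : realType) (m' n : nat).
Local Notation m := m'.+1.
Local Notation C := R[i]%C.
Local Notation T := 'I_n.
Local Notation A := 'I_m.
Local Notation W := (wreath T A).
Local Notation z := (omega R m).
Local Open Scope ring_scope.

Let zP : m.-primitive_root z. Proof. exact: omega_prim. Qed.

Let z0 : z != 0.
Proof. by rewrite (prim_root_eq0 zP). Qed.

(** Rows are indexed so that products of matrices match products in W; the
    permutation of the columns is then the inverse of w.1. *)
Definition Mx (w : W) : 'M[C]_n :=
  \matrix_(i, j) if j == w.1 i then z ^+ (w.2 i : nat) else 0.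

Lemma MxE w i j : Mx w i j = if j == w.1 i then z ^+ (w.2 i : nat) else 0.
Proof. by rewrite mxE. Qed.

Lemma Mx_neq0 w i j : (Mx w i j != 0) = (j == w.1 i).
Proof. by rewrite MxE; case: (j =P w.1 i); rewrite ?eqxx ?expf_neq0. Qed.

Lemma MxM a b : Mx (a * b)%g = Mx a *m Mx b.
Proof.
apply/matrixP=> i k; rewrite MxE wrM1 wrM2 permM mxE (bigD1 (a.1 i)) //=.
rewrite big1 => [|j /negPf ji]; last by rewrite !MxE ji mul0r.
rewrite !MxE eqxx addr0; case: eqP; rewrite ?mulr0 // => _.
by rewrite (prim_expr_mod zP) exprD.
Qed.

Lemma Mx1 : Mx 1%g = 1%:M.
Proof.
by apply/matrixP=> i j; rewrite MxE mxE wr12E perm1 eq_sym; case: eqP.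
Qed.

Lemma Mx_inj : injective Mx.
Proof.
move=> a b E; have E1 : a.1 = b.1.
  apply/permP=> i; apply/eqP; rewrite -Mx_neq0 -E Mx_neq0.
  by rewrite eqxx.
apply: wr_eq => // i; have := congr1 (fun M : 'M_n => M i (a.1 i)) E.
rewrite /= !MxE -E1 eqxx => /eqP; rewrite (eq_prim_root_expr zP).
by rewrite !modn_small // => /eqP/val_inj.
Qed.

Lemma Mx_prods s : \big[mulmx/1%:M]_(t <- map Mx s) t = Mx (prods s).
Proof.
elim: s => [|t s IHs]; first by rewrite /prods !big_nil Mx1.
by rewrite /= big_cons IHs prods_cons MxM.
Qed.

Lemma MxV_unit b : Mx b \in unitmx.
Proof. by apply: (proj1 (mulmx1_unit (B := Mx b^-1%g) _));
  rewrite -MxM mulgV Mx1. Qed.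

Lemma MxJ a b : invmx (Mx b) *m Mx a *m Mx b = Mx (a ^ b)%g.
Proof. by rewrite -mulmxA -MxM conjgC MxM mulKmx // MxV_unit. Qed.

Lemma Mx_hurwitz s s' : hurwitz s s' ->
  same_hurwitz_orbit (map Mx s) (map Mx s').
Proof.
elim=> [_ _ [p q x y]|s1|s1 s2 _|s1 s2 s3 _ h _]; last 1 first.
- exact: rst_trans.
- by rewrite !map_cat /= -MxJ; apply: rst_step; constructor.
- exact: rst_refl.
- exact: rst_sym.
Qed.

Lemma map_catI (s : seq W) s1 s2 : map Mx s = s1 ++ s2 ->
  exists p q, [/\ s = p ++ q, map Mx p = s1 & map Mx q = s2].
Proof.
elim: s1 s => [|t s1 IH] s; first by move=> E; exists [::], s.
case: s => // x s [<- /IH[p [q [-> <- <-]]]].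
by exists (x :: p), q.
Qed.

Lemma hurwitz_Mx_inv M M' : same_hurwitz_orbit M M' ->
  (forall s, M = map Mx s -> exists2 s', M' = map Mx s' & hurwitz s s') /\
  (forall s', M' = map Mx s' -> exists2 s, M = map Mx s & hurwitz s' s).
Proof.
elim=> [_ _ [M1 M2 t1 t2]|M1|M1 M2 _ [h1 h2]|M1 M2 M3 _ [h1 h2] _ [h3 h4]].
- split=> s /esym/map_catI[p [[|x [|y q]] [-> E1]]] //= [<- E2 <-].
    exists (p ++ [:: y, x ^ y & q]%g).
      by rewrite map_cat /= E1 -E2 MxJ.
    exact: hurwitz_step.
  exists (p ++ [:: x * y * x^-1, x & q]%g).
    rewrite map_cat /= E1 !MxM E2; congr (_ ++ [:: _, _ & _]).
    rewrite !mulmxA mulmxV ?MxV_unit // mul1mx -mulmxA -MxM mulgV Mx1.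
    by rewrite mulmx1.
  apply: hurwitz_sym; have := hurwitz_step p q (x * y * x^-1)%g x.
  by rewrite conjgE mulgVK mulKg.
- by split=> s ->; exists s => //; apply: hurwitz_refl.
- by split.
- split=> s; first by case/h1=> s2 /h3[s3 -> H H']; exists s3 => //;
    apply: hurwitz_trans H' H.
  by case/h4=> s2 /h2[s1 -> H H']; exists s1 => //; apply: hurwitz_trans H' H.
Qed.

Variable (p : nat).
Hypotheses (p0 : (0 < p)%N) (pm : (p %| m)%N).
Let K (a : A) := (p %| a)%N.

Lemma in_G_Mx M : reflect (exists2 w : W, M = Mx w &
  (p %| \sum_i (w.2 i : nat))%N) (in_G m p M).
Proof.
have mp0 : (0 < m %/ p)%N by rewrite divn_gt0 // dvdn_leq.
have prodE w : \prod_i \prod_(j | Mx w i j != 0) Mx w i j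
    = z ^+ (\sum_i (w.2 i : nat))%N.
  rewrite -prodrXr; apply: eq_bigr => i _.
  rewrite (big_pred1 (w.1 i)) ?MxE ?eqxx // => j; exact: Mx_neq0.
have pE k : (m %/ p).-unity_root (z ^+ k) = (p %| k)%N.
  rewrite unity_rootE -exprM -(prim_order_dvd zP).
  by rewrite -{1}(divnK pm) mulnC dvdn_pmul2r.
apply: (iffP and3P) => [[/andP[/forallP Hr /forallP Hc] /forallP Hu Hp]|[w ->
  pw]].
  have r1 i : {j | [set j | M i j != 0] == [set j]}.
    by apply: sigW; have /cards1P[j ->] := Hr i; exists j.
  pose u i := sval (r1 i).
  have uE i j : (M i j != 0) = (j == u i).
    by have /eqP/setP/(_ j) := svalP (r1 i); rewrite !inE.
  have uI : injective u.
    move=> i i' E; have /cards1P[k /setP Hk] := Hc (u i).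
    have := Hk i; have := Hk i'; rewrite !inE !uE E eqxx.
    by move=> /esym/eqP-> /esym/eqP->.
  have a_ i : {a : A | M i (u i) = z ^+ a}.
    apply: (prim_rootP zP); apply/eqP; rewrite -unity_rootE.
    by have /forallP/(_ (u i)) := Hu i; rewrite uE eqxx.
  have ME : M = Mx (wr (perm uI) [ffun i => sval (a_ i)]).
    apply/matrixP=> i j; rewrite MxE permE ffunE -uE.
    case: eqP => //= Mij; move: (uE i j).
    case: eqP => // _ /esym/eqP->; exact: (svalP (a_ i)).
  by eexists; [exact: ME | rewrite -pE -prodE -ME].
split.
- apply/andP; split; apply/forallP=> i.
    by apply/cards1P; exists (w.1 i); apply/setP=> j; rewrite !inE Mx_neq0.
  apply/cards1P; exists (w.1^-1%g i); apply/setP=> j; rewrite !inE Mx_neq0.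
  by rewrite -(inj_eq (@perm_inj _ w.1) j) permKV eq_sym.
- apply/forallP=> i; apply/forallP=> j; rewrite Mx_neq0; apply/implyP=> /eqP->.
  by rewrite MxE eqxx unity_rootE exprAC (prim_expr_order zP) expr1n.
- by rewrite prodE pE.
Qed.

Lemma Mx_sub1 w i j :
  (Mx w - 1%:M) i j = (if j == w.1 i then z ^+ (w.2 i : nat) else 0) - (j ==
    i)%:R.
Proof. by rewrite !mxE (eq_sym i j). Qed.

Lemma zX_eq1 (a : A) : (z ^+ (a : nat) == 1) = (a == 0).
Proof. by rewrite -(prim_order_dvd zP) /dvdn modn_small. Qed.

Lemma rank1_rows (D : 'M[C]_n) i : \rank D = 1%N -> row i D != 0 ->
  forall l, exists c, forall j, D l j = c * D i j.
Proof.
move=> D1 ri l.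
have Di : (D <= row i D)%MS.
  have := geq_leqif (mxrank_leqif_sup (row_sub i D)).
  by rewrite D1 => <-; rewrite lt0n mxrank_eq0.
have /sub_rVP[c E] := submx_trans (row_sub l D) Di.
exists c => j; have := congr1 (fun v : 'rV_n => v 0 j) E.
by rewrite !mxE.
Qed.

(** All the rows of Mx w - 1 are multiples of one nonzero row, at i.  The entry
    of row l on the diagonal is nonzero unless row l vanishes, so only the one
    or two indices in the support of row i are moved or scaled. *)
Lemma rank1_refl w : \rank (Mx w - 1%:M) = 1%N ->
  (exists i j c, i != j /\ w = swap i j c) \/ (exists i k,
    k != 0 /\ w = diag1 i k).
Proof.
set D := Mx w - 1%:M => D1.
have [i ri] : exists i, row i D != 0.
  apply/existsP; apply: contra_eqT D1 => /existsPn H.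
  rewrite [D](_ : _ = 0) ?mxrank0 //; apply/row_matrixP=> i.
  by rewrite row0; apply/eqP/negPn.
have prop := rank1_rows D1 ri; have DE := Mx_sub1 w; rewrite -/D in DE.
(* a row that vanishes on the diagonal is that of the identity *)
have fixed l : D l l = 0 -> w.1 l = l /\ w.2 l = 0.
  rewrite DE eqxx; case: eqP => [<- /eqP|_ /eqP]; last first.
    by rewrite sub0r oppr_eq0 oner_eq0.
  by rewrite subr_eq0 zX_eq1 => /eqP.
have Dl l : D i l = 0 -> D l l = 0.
  by move=> H; have [c ->] := prop l; rewrite H mulr0.
have [ui|ui] := eqVneq (w.1 i) i.
  right; exists i, (w.2 i).
  have off l : l != i -> w.1 l = l /\ w.2 l = 0.
    by move/negPf=> li; apply/fixed/Dl; rewrite DE ui li subr0.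
  split.
    apply: contraNneq ri => wi; apply/eqP/rowP=> l; rewrite !mxE.
    by rewrite wi ui eq_sym; case: eqP; rewrite ?subrr.
  apply: wr_eq => [|l] /=.
    by apply/permP=> l; rewrite perm1; have [->|/off[]] := eqVneq l i.
  by rewrite ffunE; case: eqP => [->|/eqP/off[]].
left; set j := w.1 i in ui *; exists i, j, (w.2 i).
have ij : i != j by rewrite eq_sym.
have off l : l != i -> l != j -> w.1 l = l /\ w.2 l = 0.
  by move=> /negPf li /negPf lj; apply/fixed/Dl; rewrite DE li lj subr0.
have wj : w.1 j = i.
  have [//|wji] := eqVneq (w.1 j) i.
  have wjj : w.1 j != j.
    by rewrite -{2}/j (inj_eq perm_inj).
  have [E _] := off _ wji wjj; case/negP: wjj.
  exact/eqP/(perm_inj E).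
have [c Hc] := prop j.
have Z : z ^+ (w.2 i : nat) * z ^+ (w.2 j : nat) = 1.
  have := Hc j; have := Hc i;
    rewrite !DE wj -/j !eqxx (negPf ij) eq_sym (negPf ij).
  rewrite subr0 !sub0r mulrN1 subr0 => -> E.
  by rewrite mulrN mulrC -E opprK.
have aij : w.2 j = - w.2 i.
  apply/eqP; rewrite -addr_eq0 addrC -zX_eq1 /= (prim_expr_mod zP) exprD.
  by rewrite Z.
split=> //; apply: wr_eq => [|l] /=.
  apply/permP=> l; case: tpermP => [->|->|/eqP li /eqP lj] //.
  by case: (off l li lj).
rewrite ffunE; case: eqP => [->//|/eqP li]; case: eqP => [->//|/eqP lj].
by case: (off l li lj).
Qed.

Lemma rank_le1 (D : 'M[C]_n) (v r : 'I_n -> C) :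
  (forall i j, D i j = v i * r j) -> (exists i j, D i j != 0) -> \rank D = 1%N.
Proof.
move=> DE [i [j Dij]]; have E : D = (\col_i v i) *m (\row_j r j).
  by apply/matrixP=> a b; rewrite DE mxE big_ord1 !mxE.
apply/eqP; rewrite eqn_leq; apply/andP; split.
  by rewrite E; apply: mulmx_max_rank.
rewrite lt0n mxrank_eq0; apply: contraNneq Dij => ->.
by rewrite mxE.
Qed.

Lemma rank_refl w : refl K w -> \rank (Mx w - 1%:M) = 1%N.
Proof.
case=> [i j c ij|i k k0 _].
  have zz : z ^+ (- c : A) * z ^+ (c : nat) = 1.
    apply/eqP; rewrite -exprD -(prim_expr_mod zP).
    by rewrite -[X in z ^+ X]/(nat_of_ord (- c + c : A)) addNr expr0.
  pose v l : C := (l == i)%:R - (l == j)%:R * z ^+ (- c : A).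
  pose r l : C := (l == j)%:R * z ^+ (c : nat) - (l == i)%:R.
  apply: (@rank_le1 _ v r); last first.
    exists i, i; rewrite Mx_sub1 /= tpermL (negPf ij) eqxx sub0r oppr_eq0.
    exact: oner_neq0.
  move=> l k; rewrite Mx_sub1 /v /r /= ffunE.
  case: tpermP => [->|->|/eqP li /eqP lj].
  - rewrite eqxx (negPf ij) mul0r subr0 mul1r.
    by case: eqP => _; rewrite ?mul1r ?mul0r.
  - rewrite eqxx [j == i]eq_sym (negPf ij) sub0r mul1r mulrBr mulNr mulrCA zz.
    rewrite mulr1 mulNr opprK.
    by rewrite [RHS]addrC; congr (_ + _); case: eqP; rewrite ?mulr1 ?mulr0.
  - rewrite (negPf li) (negPf lj) mul0r subr0 mul0r.
    by case: eqP => _; rewrite ?subrr.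
pose v l : C := (l == i)%:R; pose r l : C := (l == i)%:R * (z ^+ (k : nat) - 1).
apply: (@rank_le1 _ v r); last first.
  exists i, i; rewrite Mx_sub1 /= perm1 ffunE !eqxx subr_eq0 zX_eq1.
  exact: k0.
move=> l j; rewrite Mx_sub1 /v /r /= perm1 ffunE.
have [->|li] := eqVneq l i.
  by case: eqP => _; rewrite mul1r ?mul1r ?mul0r ?subr0.
by case: eqP => _; rewrite mul0r ?subrr ?subr0.
Qed.

Lemma sum_dvd (w : W) : (p %| \sum_i (w.2 i : nat))%N = K (\sum_i w.2 i).
Proof.
have -> : \sum_i w.2 i = inZp (\sum_i (w.2 i : nat))%N :> A.
  by rewrite inZp_sum; apply: eq_bigr => x _; rewrite valZpK.
by rewrite /K dvdn_inZp.
Qed.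

Lemma sum_wt (w : W) : \sum_i w.2 i = wt (fun=> tt) w.2 tt.
Proof. by rewrite /wt; apply: eq_bigl => i; rewrite eqxx. Qed.

Lemma reflection_Mx M : (0 < n)%N ->
  reflect (exists2 w, M = Mx w & refl K w) (reflection m p M).
Proof.
move=> n0; have rankE D : ((\rank (eigenspace D^T 1)).+1 == n) = (\rank (D -
  1%:M : 'M[C]_n) == 1%N).
  rewrite /eigenspace mxrank_ker -[1%:M](@trmx1 C) -linearB mxrank_tr trmx1.
  move: (\rank _) (rank_leq_row (D - 1%:M)) => r rn.
  by apply/eqP/eqP; move: n0 rn; lia.
apply: (iffP andP) => [[/in_G_Mx[w -> pw]]|[w -> rw]]; rewrite rankE.
  move/eqP/rank1_refl=> [[i [j [c [ij wE]]]]|[i [k [k0 wE]]]]; exists w;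
    rewrite // wE.
    exact: ReflSwap.
  apply: ReflDiag1 => //; move: pw; rewrite sum_dvd sum_wt wE.
  by rewrite (wt_diag1 (fun=> tt)) eqxx.
split; last by rewrite rank_refl.
apply/in_G_Mx; exists w; rewrite // sum_dvd sum_wt.
case: rw => [i j c ij|i k _ Kk]; first by rewrite wt_swap // /K dvdn0.
by rewrite (wt_diag1 (fun=> tt)) eqxx.
Qed.

End Matrices.

(** * Translation of the combinatorial data *)

Section Translation.
Variables (R : realType) (m' n : nat) (w : wreath 'I_n 'I_m'.+1).
Local Notation m := m'.+1.
Local Notation M := (Mx R w).

Lemma underlying_perm_Mx : underlying_perm M = w.1^-1.
Proof.
rewrite /underlying_perm; case: pickP => [u /forallP H|/(_ w.1^-1)] /=.
  apply/permP=> j; apply: (@perm_inj _ w.1).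
  by rewrite permKV; have := H j; rewrite Mx_neq0 => /eqP.
by move/forallP=> []; move=> j; rewrite Mx_neq0 permKV.
Qed.

Lemma exponent_Mx j : exponent m M j = w.2 (w.1^-1 j).
Proof.
have zP := @omega_prim R m isT.
rewrite /exponent underlying_perm_Mx MxE permKV eqxx.
case: pickP => [a /=|/(_ (w.2 (w.1^-1 j)))]; last by rewrite eqxx.
by rewrite (eq_prim_root_expr zP) !modn_small // => /eqP.
Qed.

Lemma cycles_Mx : cycles M = porbits w.1.
Proof. by rewrite /cycles underlying_perm_Mx porbitsV. Qed.

Lemma weight_Mx c : c \in porbits w.1 -> weight m M c = cycle_weight w c.
Proof.
case/imsetP=> i _ ->;
  rewrite /weight /cycle_weight (reindex_inj (@perm_inj _ w.1)).
apply: eq_big => x; first exact: stable_porbit.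
by rewrite exponent_Mx permK.
Qed.

Lemma part_weight_Mx P B : partition P (porbits w.1) -> B \in P ->
  part_weight m M B = block_weight w B.
Proof.
move=> pP BP; apply: eq_bigr => c cB; apply: weight_Mx.
by have [x ->] := in_cycle pP BP cB; apply: imset_f.
Qed.

Lemma cycle_partition_Mx p P : cycle_partition m p M P = is_cycle_partition p
  w P.
Proof.
rewrite /cycle_partition cycles_Mx /is_cycle_partition; apply: andb_id2l => pP.
apply: eq_forallb => B; apply: implyb_id2l => BP.
by rewrite (part_weight_Mx pP).
Qed.

Lemma value_Mx P : partition P (porbits w.1) ->
  value m M P = partition_value w P.
Proof.
move=> pP; congr addn; apply: eq_card => B; rewrite !inE.
by apply: andb_id2l => BP; rewrite (part_weight_Mx pP).
Qed.

Lemma Par_max_Mx p : Par_max m p M = best_partitions p w.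
Proof.
apply/setP=> P; rewrite !inE cycle_partition_Mx;
  apply: andb_id2l => /andP[pP _].
apply: eq_forallb => Q; rewrite cycle_partition_Mx;
  apply: implyb_id2l => /andP[pQ _].
by rewrite !value_Mx.
Qed.

Lemma r_part_Mx P B : partition P (porbits w.1) -> B \in P ->
  r_part m M B = gcdn m (\big[gcdn/0%N]_(c in B) cycle_weight w c).
Proof.
move=> pP BP; congr gcdn; apply: eq_bigr => c cB; apply: weight_Mx.
by have [x ->] := in_cycle pP BP cB; apply: imset_f.
Qed.

Variable p : nat.
Hypotheses (p0 : (0 < p)%N) (pm : (p %| m)%N) (n0 : (0 < n)%N).

Lemma refl_factorization_Mx s : refl_factorization m p M s <->
  exists2 ws, s = map (@Mx R m' n) ws & is_factorization p w ws.
Proof.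
split=> [[/allP H gE]|[ws -> [rs gE]]].
  have {H} [ws sE rs] : exists2 ws, s = map (@Mx R m' n) ws &
      refls (fun a : 'I_m => (p %| a)%N) ws.
    elim: s {gE} H => [|t s IHs] H; first by exists [::].
    have [|ws -> rs] := IHs; first by move=> x xs; apply: H;
      rewrite inE xs orbT.
    have /(reflection_Mx p0 pm _ n0)[t' -> rt] := H t (mem_head _ _).
    by exists (t' :: ws) => //; apply/refls_cons.
  exists ws => //; split=> //; apply: (@Mx_inj R); rewrite -gE sE.
  by rewrite Mx_prods.
split; last by rewrite Mx_prods gE.
apply/allP=> _ /mapP[t tws ->].
by apply/(reflection_Mx p0 pm _ n0); exists t => //; apply: rs.
Qed.

Lemma shortest_Mx s : shortest_refl_factorization m p M s <->
  exists2 ws, s = map (@Mx R m' n) ws & is_shortest p w ws.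
Proof.
split=> [[/refl_factorization_Mx[ws sE fs] H]|[ws -> [fs H]]].
  exists ws => //; split=> // ws' fs'.
  have := H (map (@Mx R m' n) ws'); rewrite sE !size_map; apply.
  by apply/refl_factorization_Mx; exists ws'.
split; first by apply/refl_factorization_Mx; exists ws.
by move=> _ /refl_factorization_Mx[ws' -> fs']; rewrite !size_map; apply: H.
Qed.

Lemma single_orbit_Mx :
  single_hurwitz_orbit (shortest_refl_factorization m p M) <->
  exists s, is_shortest p w s /\ forall s', is_shortest p w s' -> hurwitz s s'.
Proof.
split=> [[S HS]|[s [ss H]]].
  have /shortest_Mx[s sE ss] : shortest_refl_factorization m p M S.
    by apply/HS; apply: rst_refl.
  exists s; split=> // s' ss'.
  have /HS H0 : shortest_refl_factorization m p M (map (@Mx R m' n) s').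
    by apply/shortest_Mx; exists s'.
  have [/(_ s sE)[s2 E H] _] := hurwitz_Mx_inv m' H0.
  by rewrite (inj_map (@Mx_inj R m' n) E).
exists (map (@Mx R m' n) s) => S; split.
  by case/shortest_Mx=> s' -> /H; apply: Mx_hurwitz.
move=> H0; have [/(_ s erefl)[s' -> Hs] _] := hurwitz_Mx_inv m' H0;
  apply/shortest_Mx; exists s' => //.
exact: hurwitz_is_shortest Hs.
Qed.

End Translation.

Theorem corollary3p4 (R : realType) (m p n : nat) (m_gt0 : (0 < m)%N)
    (p_gt0 : (0 < p)%N) (n_gt0 : (0 < n)%N) (p_dvd_m : (p %| m)%N)
    (g : 'M[R[i]%C]_n) (g_in_G : in_G m p g) :
  single_hurwitz_orbit (shortest_refl_factorization m p g) <->
  (exists P : {set {set {set 'I_n}}},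
     Par_max m p g = [set P] /\
     (forall B : {set {set 'I_n}}, B \in P ->
       #|B| = 1%N \/ r_part m g B = 1%N)).
Proof.
case: m m_gt0 p_dvd_m g_in_G => // m' _ pm /(in_G_Mx p_gt0 pm)[w -> _].
rewrite (single_orbit_Mx R w p_gt0 pm n_gt0) Par_max_Mx.
have rE P : best_partitions p w = [set P] -> forall B, B \in P ->
    r_part m'.+1 (Mx R w) B = gcdn m'.+1 (\big[gcdn/0%N]_(c in B) cycle_weight
      w c).
  move=> E B BP; apply: r_part_Mx BP.
  by have : P \in best_partitions p w by [rewrite E inE];
    rewrite inE => /andP[/andP[]].
split=> [[s [ss H]]|[P [E H]]].
  have [P [E HB]] := transitive_best_partition pm ss H.
  by exists P; split=> // B BP; rewrite (rE P E B BP); apply: HB.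
by apply: (best_partition_transitive pm E) => B BP; rewrite -(rE P E B BP);
  apply: H.
Qed.
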